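(* Let $r\ge 1$ and $c_1,\dots,c_r\in\{0,1\}$, $\mathbf c=(c_1,\dots,c_r)$. Then the limit $\rho^r(\mathbf c,2)=\lim_{Q\to\infty}\rho^r_Q(\mathbf c,2)$ exists. Moreover, $\rho^1(0;2)=1/3$, $\rho^1(1;2)=2/3$, $\rho^2(0,1;2)=\rho^2(1,0;2)=\rho^2(1,1;2)=1/3$, and for $r\ge 3$, $$\rho^r(\mathbf c,2)=\frac23\sum_{\mathbf k\in\mathcal K^{r-2}(\mathbf c,2)}\mathrm{Area}\big(\mathcal T[\mathbf k]\big).$$
   Context: For a positive integer $Q$, the Farey sequence $\mathfrak F_Q$ is the increasing sequence of reduced fractions $a/q\in[0,1]$ with $1\le q\le Q$. For $\mathbf c=(c_1,\dots,c_r)$ with $0\le c_j\le d-1$, let $N^r_Q(\mathbf c,d)$ be the number of $r$-tuples of denominators $(q_1,\dots,q_r)$ of $r$ consecutive elements of $\mathfrak F_Q$ with $q_j\equiv c_j\pmod d$ for all $j$, and $\rho^r_Q(\mathbf c,d)=N^r_Q(\mathbf c,d)/(\#\mathfrak F_Q-(r-1))$; for $r=1,2$ we write e.g. $\rho^1(c_1;d)$, $\rho^2(c_1,c_2;d)$ for the limits. Let $\mathcal T=\{(x,y)\in\mathbb R^2:0<x\le1,\ 0<y\le 1,\ x+y>1\}$ and $\mathcal T_Q=Q\mathcal T$. For $(x,y)\in\mathcal T$ define $L_{-1}=x$, $L_0=y$ and for $j\ge1$, $L_j=\left\lfloor\frac{1+L_{j-2}}{L_{j-1}}\right\rfloor L_{j-1}-L_{j-2}$,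 and $k_j(x,y)=\left\lfloor\frac{1+L_{j-2}}{L_{j-1}}\right\rfloor$. For $\mathbf k\in(\mathbb N^* )^s$ put $\mathcal T[\mathbf k]=\{(x,y)\in\mathcal T:(k_1(x,y),\dots,k_s(x,y))=\mathbf k\}$. For $Q\ge1$ and a lattice point $(q',q'')\in\mathcal T_Q$ with $\gcd(q',q'')=1$, define $q_1=q'$, $q_2=q''$, and recursively $k_j=\lfloor (Q+q_j)/q_{j+1}\rfloor$, $q_{j+2}=k_jq_{j+1}-q_j$; set $\mathbf q(q',q'')=(q_1,\dots,q_r)$ and $\mathbf k(q',q'')=(k_1,\dots,k_{r-2})$. The set $\mathcal A^{s}$ of admissible vectors consists of all $\mathbf k\in(\mathbb N^* )^s$ of the form $\mathbf k(q',q'')$ for some $Q\ge 1$ and some coprime lattice point $(q',q'')\in\mathcal T_Q$. Finally, $\mathcal K^{r-2}(\mathbf c,d)$ is the set of $\mathbf k\in\mathcal A^{r-2}$ for which there exist $Q\ge1$ and a lattice point $(q',q'')\in\mathcal T_Q$ with $\gcd(q',q'')=1$, $\mathbf k(q',q'')=\mathbf k$ and $\mathbf q(q',q'')\equiv\mathbf c\pmod d$ componentwise. *)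

(* Defs.v *)
From HB Require Import structures.
From mathcomp Require Import all_boot all_order all_algebra.
From mathcomp Require Import all_classical all_reals all_analysis.

Set Implicit Arguments.
Unset Strict Implicit.
Unset Printing Implicit Defensive.
Import Order.TTheory GRing.Theory Num.Theory.
Import numFieldNormedType.Exports.
Local Open Scope classical_set_scope.
Local Open Scope ring_scope.

Definition farey (Q : nat) : seq rat :=
  sort <=%R [seq a%:R / q%:R | q <- iota 1 Q, a <- [seq a <- iota 0 q.+1 | coprime a q]].

Definition farey_den (Q : nat) : seq nat := [seq `|denq x|%N | x <- farey Q].

Definition congr_mod (d r : nat) (q : nat -> nat) (c : r.-tuple nat) : Prop :=
  forall j : 'I_r, q j = tnth c j %[mod d].

(* The r-tuples are counted by the position i at which they start: for r = 1
   the same denominator occurs several times. *)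
Definition farey_count (Q r : nat) (c : r.-tuple nat) (d : nat) : nat :=
  count (fun i => `[< congr_mod d (fun j => nth 0%N (farey_den Q) (i + j)) c >])
        (iota 0 (size (farey Q) - (r - 1))).

Definition rhoQ (R : realType) (r : nat) (c : r.-tuple nat) (d Q : nat) : R :=
  (farey_count Q c d)%:R / ((size (farey Q))%:R - (r%:R - 1)).

(* Meaningful only when the sequence converges. *)
Definition rho (R : realType) (r : nat) (c : r.-tuple nat) (d : nat) : R :=
  limn (rhoQ R c d).

Definition fareyT (R : realType) : set (R * R) :=
  [set p | [/\ 0 < p.1 <= 1, 0 < p.2 <= 1 & 1 < p.1 + p.2]].

(* Indices are shifted by one: [Lseq p n] is L_{n-1}(p). *)
Fixpoint Lseq (R : realType) (p : R * R) (n : nat) : R :=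
  match n with
  | 0 => p.1
  | n1.+1 =>
    match n1 with
    | 0 => p.2
    | n2.+1 => (Num.floor ((1 + Lseq p n2) / Lseq p n1))%:~R * Lseq p n1 - Lseq p n2
    end
  end.

(* [kidx p j] is k_{j+1}(p). *)
Definition kidx (R : realType) (p : R * R) (j : nat) : int :=
  Num.floor ((1 + Lseq p j) / Lseq p j.+1).

Definition fareyTk (R : realType) (s : nat) (k : s.-tuple nat) : set (R * R) :=
  [set p | fareyT p /\ forall j : 'I_s, kidx p j = (tnth k j)%:Z].

Arguments fareyTk R {s} k.

Definition area (R : realType) (A : set (R * R)) : \bar R :=
  (@lebesgue_measure R \x @lebesgue_measure R)%E A.

Definition lattice_pt (Q q' q'' : nat) : Prop :=
  [/\ (0 < q' <= Q)%N, (0 < q'' <= Q)%N, (Q < q' + q'')%N & coprime q' q''].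

(* [qseq Q q' q'' j] is q_{j+1}. On lattice points of T_Q the truncated
   subtraction is exact, as k_j q_{j+1} > Q + q_j - q_{j+1} >= q_j. *)
Fixpoint qseq (Q q' q'' : nat) (n : nat) : nat :=
  match n with
  | 0 => q'
  | n1.+1 =>
    match n1 with
    | 0 => q''
    | n2.+1 => ((Q + qseq Q q' q'' n2) %/ qseq Q q' q'' n1) * qseq Q q' q'' n1
               - qseq Q q' q'' n2
    end
  end%N.

(* [kseq Q q' q'' j] is k_{j+1}. *)
Definition kseq (Q q' q'' : nat) (j : nat) : nat :=
  ((Q + qseq Q q' q'' j) %/ qseq Q q' q'' j.+1)%N.

Definition has_kvec (s : nat) (Q q' q'' : nat) (k : s.-tuple nat) : Prop :=
  forall j : 'I_s, kseq Q q' q'' j = tnth k j.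

Definition admissible (s : nat) : set (s.-tuple nat) :=
  [set k | (forall j, (0 < tnth k j)%N) /\
     exists Q q' q'' : nat,
       [/\ (1 <= Q)%N, lattice_pt Q q' q'' & has_kvec Q q' q'' k]].

Definition Kset (r : nat) (c : r.-tuple nat) (d : nat) : set ((r - 2).-tuple nat) :=
  [set k | admissible k /\
     exists Q q' q'' : nat,
       [/\ (1 <= Q)%N, lattice_pt Q q' q'', has_kvec Q q' q'' k &
           congr_mod d (qseq Q q' q'') c]].

(* Main.v *)
(* Consecutive denominators in the Farey sequence of order Q are exactly the
   coprime lattice points of Q T, each occurring once, and the following
   denominators are obtained by iterating the map defining the indices k_j.
   Modulo 2 the whole r-tuple is determined by k and by the parities of the
   first two denominators; so the tuples congruent to c are the coprime points
   of Q A with prescribed parities, where A is the union of the T[k] for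
   k in K(c, 2).

   A sieve by z! counts the coprime points of a given parity class in a dyadic
   cell: there are asymptotically kappa * area * Q^2 of them, with the same
   kappa > 0 for the three classes other than (even, even), since GL_2(Z)
   permutes them.  The value of kappa is irrelevant: it cancels in the
   quotient by the number 3 kappa / 2 * Q^2 of all pairs.

   To pass from cells to A, exhaust by dyadic cells an open subset of A and an
   open subset of the complement of A in the unit square.  These lower bounds
   add up to the count for the whole square, because what is left over lies on
   the countably many lines a x + b y = 1 with integers a and b. *)

Require Import Defs.
From HB Require Import structures.
From mathcomp Require Import all_boot all_order all_algebra.
From mathcomp Require Import all_classical all_reals all_analysis.
From mathcomp Require Import zify ring lra.

Set Implicit Arguments.
Unset Strict Implicit.
Unset Printing Implicit Defensive.
Import Order.TTheory GRing.Theory Num.Theory.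
Import numFieldNormedType.Exports.
Local Open Scope classical_set_scope.
Local Open Scope ring_scope.

(** * Lattice points in cells and residue classes *)

Definition cnt (Q : nat) (S : nat -> nat -> bool) : nat :=
  (\sum_(p : 'I_Q.+1 * 'I_Q.+1) S p.1 p.2)%N.

Lemma cnt_le Q (S1 S2 : nat -> nat -> bool) :
  (forall a b, (a <= Q)%N -> (b <= Q)%N -> S1 a b -> S2 a b) ->
  (cnt Q S1 <= cnt Q S2)%N.
Proof.
move=> h; apply: leq_sum => -[a b] _ /=.
case E : (S1 a b) => //=.
by rewrite h //; [exact: ltn_ord a|exact: ltn_ord b].
Qed.

Lemma eq_cnt Q (S1 S2 : nat -> nat -> bool) :
  (forall a b, (a <= Q)%N -> (b <= Q)%N -> S1 a b = S2 a b) ->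
  cnt Q S1 = cnt Q S2.
Proof.
by move=> h; apply/eqP; rewrite eqn_leq !cnt_le // => a b ha hb; rewrite h.
Qed.

Lemma cnt_split Q (S P : nat -> nat -> bool) :
  cnt Q S = (cnt Q (fun a b => S a b && P a b) +
             cnt Q (fun a b => S a b && ~~ P a b))%N.
Proof.
rewrite /cnt -big_split /=; apply: eq_bigr => -[a b] _ /=.
by case: (S a b); case: (P a b).
Qed.

Lemma cntU_le Q (S1 S2 S : nat -> nat -> bool) :
  (forall a b, (a <= Q)%N -> (b <= Q)%N -> S a b -> S1 a b || S2 a b) ->
  (cnt Q S <= cnt Q S1 + cnt Q S2)%N.
Proof.
move=> h; rewrite /cnt -big_split /=; apply: leq_sum => -[a b] _ /=.
have := h a b (ltn_ord a) (ltn_ord b).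
by case: (S a b); case: (S1 a b); case: (S2 a b) => // /(_ isT).
Qed.

(** Induction on [X]: by [divnS] the quotient grows by one exactly when [M] divides [X + (M - u)],
    that is when [X] has residue [u]. *)
Lemma count_modn (M u X : nat) : (u < M)%N ->
  (\sum_(a < X) (a %% M == u))%N = ((X + (M - u.+1)) %/ M)%N.
Proof.
move=> uM; elim: X => [|X IH].
  by rewrite big_ord0 add0n divn_small //; lia.
rewrite big_ord_recr /= IH addSn divnS; last by lia.
rewrite addnC; congr addn; congr nat_of_bool.
have -> : (X + (M - u.+1)).+1 = (X + (M - u))%N by lia.
apply/eqP/idP => [<-|].
  rewrite {1}(divn_eq X M) -addnA subnKC; last by rewrite ltnW // ltn_pmod; lia.
  by rewrite dvdn_addl // dvdn_mull.
case/dvdnP=> t Xt; have -> : X = ((t.-1) * M + u)%N.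
  by case: t Xt => [|t] /=; rewrite ?mulSn; lia.
by rewrite modnMDl modn_small.
Qed.

Section Equi.
Variable R : realType.

Lemma cvg_ratio (x : nat -> R) (c C : R) :
  (forall Q, `|x Q - c * Q%:R| <= C) -> (x Q / Q%:R) @[Q --> \oo] --> c.
Proof.
move=> h; apply/cvgrPdist_le => e e0; near=> Q.
have Q0 : 0 < Q%:R :> R by rewrite ltr0n; near: Q; exact: nbhs_infty_gt.
have -> : c - x Q / Q%:R = - (x Q - c * Q%:R) / Q%:R by field; rewrite gt_eqF.
rewrite normrM normrN normfV (gtr0_norm Q0) ler_pdivrMr //.
apply: le_trans (h Q) _; rewrite mulrC -ler_pdivrMr //.
near: Q; exact: nbhs_infty_ger.
Unshelve. all: by end_near. Qed.

Lemma cvgn_near_eq (f g : nat -> R) (l : R) :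
  (\forall n \near \oo, f n = g n) ->
  f n @[n --> \oo] --> l -> g n @[n --> \oo] --> l.
Proof.
move=> fg; apply: cvg_trans; exact: near_eq_cvg.
Qed.

Lemma cvgnB (f g : nat -> R) (a b : R) :
  f n @[n --> \oo] --> a -> g n @[n --> \oo] --> b ->
  (f n - g n) @[n --> \oo] --> a - b.
Proof. by move=> fa gb; exact: cvgB. Qed.

Lemma cvgnD (f g : nat -> R) (a b : R) :
  f n @[n --> \oo] --> a -> g n @[n --> \oo] --> b ->
  (f n + g n) @[n --> \oo] --> a + b.
Proof. by move=> fa gb; exact: cvgD. Qed.

Lemma cvgnM (f g : nat -> R) (a b : R) :
  f n @[n --> \oo] --> a -> g n @[n --> \oo] --> b ->
  (f n * g n) @[n --> \oo] --> a * b.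
Proof. by move=> fa gb; exact: cvgM. Qed.

Lemma cvgn_sum (I : finType) (f : I -> nat -> R) (a : I -> R) :
  (forall i, f i n @[n --> \oo] --> a i) ->
  (\sum_i f i n) @[n --> \oo] --> \sum_i a i.
Proof. by move=> fa; apply: cvg_big => // x; exact: add_continuous. Qed.

(** The condition [i / D < a / Q <= (i + 1) / D] with denominators cleared, so that counting stays
    in [nat]. Half-open cells tile the interval from 0 excluded to 1 included. *)
Definition cell (D i Q a : nat) : bool := (i * Q < a * D <= i.+1 * Q)%N.

Lemma count_le_mod (D M u i Q : nat) : (0 < D)%N -> (u < M)%N -> (i <= D)%N ->
  (\sum_(a < Q.+1) ((a * D <= i * Q) && (a %% M == u)))%N =
  (((i * Q) %/ D + (M - u)) %/ M)%N.
Proof.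
move=> D0 uM iD.
have wQ : (((i * Q) %/ D).+1 <= Q.+1)%N.
  by rewrite ltnS -{2}(mulKn Q D0) leq_div2r // leq_mul2r iD orbT.
transitivity (\sum_(a < ((i * Q) %/ D).+1) (a %% M == u))%N.
  rewrite (big_ord_widen_cond _ xpredT (fun a => (a %% M == u)%N : nat) wQ) /=.
  rewrite [RHS]big_mkcond /=; apply: eq_bigr => a _.
  by rewrite ltnS leq_divRL //; case: leqP.
by rewrite count_modn //; congr (_ %/ _)%N; lia.
Qed.

Lemma cvg_count_le_mod (D M u i : nat) : (0 < D)%N -> (u < M)%N -> (i <= D)%N ->
  ((\sum_(a < Q.+1) ((a * D <= i * Q) && (a %% M == u)))%N%:R / Q%:R : R)
    @[Q --> \oo] --> (i%:R / (D * M)%:R : R).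
Proof.
move=> D0 uM iD.
(* The constant 1: the two nested floors together stay within 1 of [i * Q / (D * M)]; [h5] and [h6]
   below say this after multiplication by [D * M]. *)
apply: (@cvg_ratio (fun Q => _) _ 1) => Q; rewrite count_le_mod //.
set w := (_ %/ D)%N; set t := (_ %/ M)%N.
have M0 : (0 < M)%N by lia.
have h1 := leq_trunc_div (i * Q) D; have h2 := ltn_ceil (i * Q) D0.
have h3 := leq_trunc_div (w + (M - u)) M; have h4 := ltn_ceil (w + (M - u)) M0.
rewrite -/w in h1 h2; rewrite -/t in h3 h4.
have h5 : (t * (D * M) <= i * Q + D * M)%N by nia.
have h6 : (i * Q <= t * (D * M) + D * M)%N by nia.
have DM0 : 0 < (D * M)%:R :> R by rewrite ltr0n; nia.
rewrite -(ler_pM2r DM0) mul1r -[X in _ * X <= _](gtr0_norm DM0) -normrM.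
have -> : (t%:R - i%:R / (D * M)%:R * Q%:R) * (D * M)%:R
    = (t * (D * M))%:R - (i * Q)%:R :> R.
  by rewrite !natrM; field; rewrite !pnatr_eq0 -!lt0n D0 M0.
rewrite ler_norml; apply/andP; split; first last.
  by rewrite lerBlDr addrC -natrD ler_nat.
by rewrite lerBrDr addrC lerBlDr -natrD ler_nat.
Qed.

Lemma cvg_count_cell_mod (D M u i : nat) : (0 < D)%N -> (u < M)%N -> (i < D)%N ->
  ((\sum_(a < Q.+1) (cell D i Q a && (a %% M == u)))%N%:R / Q%:R : R)
    @[Q --> \oo] --> (((D * M)%:R)^-1 : R).
Proof.
move=> D0 uM iD.
have -> : ((D * M)%:R)^-1 = i.+1%:R / (D * M)%:R - i%:R / (D * M)%:R :> R.
  by rewrite -mulrBl -natrB // subSnn mul1r.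
have H := cvgnB (cvg_count_le_mod D0 uM iD) (cvg_count_le_mod D0 uM (ltnW iD)).
apply: (cvgn_near_eq _ H); apply: nearW => Q /=.
rewrite /= -mulrBl; congr (_ / _); apply/eqP; rewrite subr_eq -natrD; apply/eqP.
congr (_%:R); rewrite -big_split /=; apply: eq_bigr => a _.
rewrite /cell ltnNge mulSn.
by case: (leqP (a * D) (i * Q)) => h /=; [rewrite (leq_trans h) ?leq_addl //|]; lia.
Qed.

End Equi.

Lemma cntE Q S : cnt Q S = (\sum_(a < Q.+1) \sum_(b < Q.+1) S a b)%N.
Proof. by rewrite /cnt pair_bigA. Qed.

(** Sorting the pairs by their residues modulo [M] makes [f] constant on each class, and each class
    is a product of two one-dimensional counts. *)
Lemma cnt_cell_modE (D M i j Q : nat) (f : nat -> nat -> bool) : (0 < M)%N ->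
  (cnt Q (fun a b => [&& cell D i Q a, cell D j Q b & f (a %% M) (b %% M)]) =
   \sum_(p : 'I_M * 'I_M) f p.1 p.2 *
     ((\sum_(a < Q.+1) (cell D i Q a && (a %% M == p.1))) *
      (\sum_(b < Q.+1) (cell D j Q b && (b %% M == p.2)))))%N.
Proof.
move=> M0.
under eq_bigr => p _.
  rewrite big_distrlr big_distrr /=.
  under eq_bigr do rewrite big_distrr /=.
  over.
rewrite exchange_big cntE /=; apply: eq_bigr => a _.
rewrite exchange_big /=; apply: eq_bigr => b _.
rewrite (bigD1 (Ordinal (ltn_pmod a M0), Ordinal (ltn_pmod b M0))) //= !eqxx.
rewrite big1 => [|[u v] /= uv].
  by rewrite addn0; case: (cell D i Q a); case: (cell D j Q b); case: (f _ _).
case: (a %% M =P u)%N => [au|]; last by rewrite andbF muln0.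
case: (b %% M =P v)%N => [bv|]; last by rewrite andbF !muln0.
case/negP: uv; apply/eqP; congr (_, _); exact/val_inj.
Qed.

(** * Tail estimates for pairs with a large common divisor *)

Section Sieve.
Variable R : realType.

Lemma cvg_cnt_cell_mod (D M i j : nat) (f : nat -> nat -> bool) :
  (0 < D)%N -> (0 < M)%N -> (i < D)%N -> (j < D)%N ->
  ((cnt Q (fun a b => [&& cell D i Q a, cell D j Q b & f (a %% M) (b %% M)%N]%N))%:R
     / Q%:R ^+ 2 : R) @[Q --> \oo] -->
  ((\sum_(p : 'I_M * 'I_M) f p.1 p.2)%N%:R / (D * M)%:R ^+ 2 : R).
Proof.
move=> D0 M0 iD jD.
rewrite natr_sum mulr_suml.
apply: (@cvgn_near_eq _ (fun Q => \sum_(p : 'I_M * 'I_M) (f p.1 p.2)%:R *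
     (((\sum_(a < Q.+1) (cell D i Q a && (a %% M == p.1)))%N%:R / Q%:R) *
      ((\sum_(b < Q.+1) (cell D j Q b && (b %% M == p.2)))%N%:R / Q%:R)))).
  apply: nearW => Q; rewrite cnt_cell_modE // natr_sum mulr_suml.
  by apply: eq_bigr => p _; rewrite !natrM -!mulrA mulrCA !mulrA expr2 invfM; ring.
apply: cvgn_sum => p; apply: cvgnM; first exact: cvg_cst.
by rewrite expr2 invfM; apply: cvgnM; exact: cvg_count_cell_mod.
Qed.

Lemma count_dvdn (d Q : nat) : (0 < d)%N ->
  (\sum_(a < Q.+1) ((0 < a) && (d %| a)))%N = (Q %/ d)%N.
Proof.
move=> d0; elim: Q => [|Q IH]; first by rewrite big_ord1 div0n.
by rewrite big_ord_recr IH /= divnS // addnC.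
Qed.

(** Union bound: the term of index [d] counts the pairs with both entries divisible by [d.+1], and a
    pair with gcd [g > z] is found in the term [d = g - 1]. *)
Lemma cnt_gcd_gt_nat (z Q : nat) :
  (cnt Q (fun a b => [&& 0 < a, 0 < b & z < gcdn a b]) <=
   \sum_(z <= d < Q) (Q %/ d.+1) ^ 2)%N.
Proof.
under eq_bigr do rewrite -count_dvdn // -mulnn big_distrlr /=.
rewrite cntE [X in (_ <= X)%N]exchange_big /=; apply: leq_sum => a _.
rewrite [X in (_ <= X)%N]exchange_big /=; apply: leq_sum => b _.
case: (boolP [&& _, _ & _]) => //= /and3P[a0 b0 zg].
have gQ : ((gcdn a b).-1 < Q)%N.
  have := dvdn_leq a0 (dvdn_gcdl a b); have := ltn_ord a; lia.
rewrite (big_cat_nat (n := (gcdn a b).-1)) /=; [|lia|lia].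
rewrite [X in (_ + X)%N]big_ltn // prednK; last by lia.
by rewrite a0 b0 dvdn_gcdl dvdn_gcdr; lia.
Qed.

Lemma sum_inv_sqr_le (z Q : nat) : (0 < z)%N ->
  \sum_(z <= d < Q) (d.+1%:R ^+ 2)^-1 <= z%:R^-1 :> R.
Proof.
move=> z0; have [Qz|zQ] := leqP Q z.
  by rewrite big_geq // invr_ge0.
(* Telescoping, from [1 / (d + 1) ^ 2 <= 1 / d - 1 / (d + 1)]; keeping the term [- 1 / Q] is what
   makes the induction on [Q] go through. *)
suff : \sum_(z <= d < Q) (d.+1%:R ^+ 2)^-1 <= z%:R^-1 - Q%:R^-1 :> R.
  by move/le_trans; apply; rewrite gerBl invr_ge0.
elim: Q zQ => // Q IH; rewrite ltnS leq_eqVlt => /orP[/eqP <-|zQ].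
  rewrite big_nat1 -natr1.
  have : 0 < z%:R :> R by rewrite ltr0n.
  move: (z%:R : R) => x x0.
  have -> : x^-1 - (x + 1)^-1 = (x * (x + 1))^-1.
    by field; rewrite !gt_eqF //; lra.
  by rewrite lef_pV2 ?posrE ?expr2 ?ler_pM2r; nra.
rewrite big_nat_recr /=; last by lia.
apply: le_trans (lerD (IH zQ) (lexx _)) _.
rewrite -natr1.
have : 0 < Q%:R :> R by rewrite ltr0n; lia.
move: (Q%:R : R) => x x0.
have e : x^-1 - (x + 1)^-1 = (x * (x + 1))^-1.
  by field; rewrite !gt_eqF //; lra.
have : ((x + 1) ^+ 2)^-1 <= (x * (x + 1))^-1.
  by rewrite lef_pV2 ?posrE ?expr2 ?ler_pM2r; nra.
by rewrite -e; lra.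
Qed.

(** The bound [c] on the tail is a parameter because two values serve: [1 / z] from [sum_inv_sqr_le]
    in the sieve, and the sharper 3/4 at [z = 1]. *)
Lemma cnt_gcd_gt (z Q : nat) (c : R) :
  \sum_(z <= d < Q) (d.+1%:R ^+ 2)^-1 <= c ->
  (cnt Q (fun a b => [&& 0 < a, 0 < b & z < gcdn a b]%N))%:R <= c * Q%:R ^+ 2.
Proof.
move=> hc; apply: le_trans (_ : (\sum_(z <= d < Q) (Q %/ d.+1) ^ 2)%N%:R <= _).
  by rewrite ler_nat cnt_gcd_gt_nat.
apply: le_trans (ler_wpM2r _ hc); last exact: sqr_ge0.
rewrite natr_sum mulr_suml; apply: ler_sum => d _.
rewrite natrX mulrC ler_pdivlMr ?exprn_gt0 ?ltr0n // -exprMn -natrM.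
by rewrite lerXn2r ?nnegrE // ler_nat leq_trunc_div.
Qed.

Lemma cnt_pos Q : cnt Q (fun a b => (0 < a) && (0 < b))%N = (Q ^ 2)%N.
Proof.
rewrite cntE -mulnn -[in RHS](divn1 Q) -(@count_dvdn 1 Q) // big_distrlr /=.
by apply: eq_bigr => a _; apply: eq_bigr => b _; rewrite !dvd1n !andbT mulnb.
Qed.

Lemma cnt_coprime_ge (Q : nat) :
  4^-1 * Q%:R ^+ 2 <= (cnt Q (fun a b => [&& 0 < a, 0 < b & coprime a b]%N))%:R :> R.
Proof.
have h : (cnt Q (fun a b => (0 < a) && (0 < b)) <=
   cnt Q (fun a b => [&& 0 < a, 0 < b & coprime a b]) +
   cnt Q (fun a b => [&& 0 < a, 0 < b & 1 < gcdn a b]))%N.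
  apply: cntU_le => a b _ _ /andP[a0 b0]; rewrite a0 b0 /= /coprime.
  have : (0 < gcdn a b)%N by rewrite gcdn_gt0 a0.
  by lia.
move: h; rewrite cnt_pos -(ler_nat R) natrD natrX.
have : (cnt Q (fun a b => [&& 0 < a, 0 < b & 1 < gcdn a b]%N))%:R <= (3 / 4) * Q%:R ^+ 2 :> R.
  (* 3/4 is the first term 1/4 plus the bound 1/2 for the sum from [d = 2] on. A constant below 1 is
     essential here. *)
  apply: cnt_gcd_gt; have [Q1|Q1] := leqP Q 1; first by rewrite big_geq //; lra.
  by rewrite big_ltn //; have := @sum_inv_sqr_le 2 Q isT; rewrite -natrX; lra.
by lra.
Qed.
End Sieve.

(** * Coprime points in a parity class *)

Lemma coprime_odd a b : coprime a b -> odd a || odd b.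
Proof.
move=> cab; apply/negPn/negP; rewrite negb_or => /andP[].
rewrite -!dvdn2 => da db.
by have := dvdn_gcd 2 a b; rewrite (eqP cab) da db.
Qed.

Definition prim (e1 e2 : bool) (a b : nat) : bool :=
  [&& (0 < a)%N, (0 < b)%N, coprime a b, odd a == e1 & odd b == e2].

(** Approximation of [prim] in which coprimality is tested only against the primes dividing [M]; for
    even [M] it depends on the residues modulo [M] alone. *)
Definition sieved (M : nat) (e1 e2 : bool) (a b : nat) : bool :=
  [&& coprime (gcdn a b) M, odd a == e1 & odd b == e2].

Lemma sieved_mod M e1 e2 a b : ~~ odd M ->
  sieved M e1 e2 (a %% M) (b %% M) = sieved M e1 e2 a b.
Proof.
move=> M2; rewrite /sieved !odd_mod ?(negbTE M2) //; congr andb.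
have E x y : gcdn (gcdn x y) M = gcdn (gcdn x M) (gcdn y M).
  by rewrite gcdnACA gcdnn.
by rewrite /coprime !E !gcdn_modl.
Qed.

(* The substitutions (a, b) -> (a, a + b) and (a, b) -> (b, a) permute the
   three parity classes of primitive vectors. *)
Lemma sieved_class M e1 e2 : (0 < M)%N -> ~~ odd M -> e1 || e2 ->
  (\sum_(p : 'I_M * 'I_M) sieved M e1 e2 p.1 p.2 =
   \sum_(p : 'I_M * 'I_M) sieved M true false p.1 p.2)%N.
Proof.
case: M => // M _ M2.
have TT : (\sum_(p : 'I_M.+1 * 'I_M.+1) sieved M.+1 true true p.1 p.2 =
           \sum_(p : 'I_M.+1 * 'I_M.+1) sieved M.+1 true false p.1 p.2)%N.
  pose h (p : 'I_M.+1 * 'I_M.+1) := (p.1, p.1 + p.2).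
  have h_inj : injective h.
    move=> [a b] [c d] /eqP; rewrite xpair_eqE /= => /andP[/eqP ac].
    by rewrite ac => /eqP /addrI ->.
  rewrite (reindex_inj h_inj) /=; apply: eq_bigr => -[a b] _ /=.
  transitivity (sieved M.+1 true true (a %% M.+1)%N ((a + b)%N %% M.+1)%N : nat).
    by rewrite [in RHS]modn_small.
  rewrite sieved_mod //.
  rewrite /sieved gcdnDl oddD; congr (nat_of_bool (_ && _)).
  by case: (odd a); case: (odd b).
case: e1; case: e2 => // _.
pose h (p : 'I_M.+1 * 'I_M.+1) := (p.2, p.1).
have h_inj : injective h by move=> [a b] [c d] [-> ->].
rewrite (reindex_inj h_inj) /=; apply: eq_bigr => -[a b] _ /=.
by rewrite /sieved gcdnC [X in _ && X]andbC.
Qed.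

Lemma even_fact z : ~~ odd z.+2`!.
Proof. by rewrite -dvdn2 dvdn_fact. Qed.

Section Kappa.
Variable R : realType.

(** The density of sieved pairs of residues. The shift in [z.+2] keeps the modulus even, so that
    parities can be read off residues. *)
Definition nu (z : nat) (e1 e2 : bool) : R :=
  (\sum_(p : 'I_z.+2`! * 'I_z.+2`!) sieved z.+2`! e1 e2 p.1 p.2)%N%:R
    / (z.+2`!)%:R ^+ 2.

(** The infimum exists without any convergence proof for [nu]; [kappa_le] and [kappa_ge] then
    squeeze it. It equals 2 over pi squared, one third of the density of coprime pairs. *)
Definition kappa : R := inf (range (fun z => nu z true false)).

Lemma cvg_sieved (D i j z : nat) (e1 e2 : bool) :
  (0 < D)%N -> (i < D)%N -> (j < D)%N ->
  ((cnt Q (fun a b => [&& cell D i Q a, cell D j Q b & sieved z.+2`! e1 e2 a b]))%:R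
     / Q%:R ^+ 2 : R) @[Q --> \oo] --> nu z e1 e2 / D%:R ^+ 2.
Proof.
move=> D0 iD jD.
have := @cvg_cnt_cell_mod R D z.+2`! i j (sieved z.+2`! e1 e2) D0 (fact_gt0 _) iD jD.
rewrite /nu natrM exprMn invfM mulrA mulrAC; apply: cvgn_near_eq; apply: nearW => Q.
congr (_%:R / _); apply: eq_cnt => a b _ _.
by rewrite sieved_mod // even_fact.
Qed.

Lemma cell_gt0 D i Q a : cell D i Q a -> (0 < a)%N.
Proof. by case: a => // /andP[]; rewrite mul0n ltn0. Qed.

Lemma cnt_prim_sieved (D i j z Q : nat) (e1 e2 : bool) :
  (cnt Q (fun a b => [&& cell D i Q a, cell D j Q b & prim e1 e2 a b]) <=
   cnt Q (fun a b => [&& cell D i Q a, cell D j Q b & sieved z.+2`! e1 e2 a b]))%N.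
Proof.
apply: cnt_le => a b _ _ /and3P[-> -> /and5P[_ _ ab ha hb]].
by rewrite /sieved ha hb (eqP ab) coprime1n.
Qed.

(** If a sieved pair has gcd at most [z.+2], the gcd divides the factorial and is coprime to it,
    hence is 1. All other pairs fall under the tail bound [cnt_gcd_gt]. *)
Lemma cnt_sieved_prim (D i j z Q : nat) (e1 e2 : bool) :
  (cnt Q (fun a b => [&& cell D i Q a, cell D j Q b & sieved z.+2`! e1 e2 a b]))%:R
  <= (cnt Q (fun a b => [&& cell D i Q a, cell D j Q b & prim e1 e2 a b]))%:R
     + z.+1%:R^-1 * Q%:R ^+ 2 :> R.
Proof.
have := @cnt_gcd_gt R z.+1 Q _ (sum_inv_sqr_le R Q (ltn0Sn z)).
rewrite -(lerD2l (cnt Q (fun a b => [&& cell D i Q a, cell D j Q b & prim e1 e2 a b]))%:R).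
apply: le_trans; rewrite -natrD ler_nat.
apply: cntU_le => a b _ _ /and3P[ca cb /and3P[cop ea eb]].
have a0 := cell_gt0 ca; have b0 := cell_gt0 cb.
rewrite ca cb /prim a0 b0 ea eb /= !andbT.
have g0 : (0 < gcdn a b)%N by rewrite gcdn_gt0 a0.
rewrite /coprime; have [gz|] := leqP (gcdn a b) z.+2; last by move=> h; lia.
have : (gcdn a b %| z.+2`!)%N by rewrite dvdn_fact // g0.
by move/gcdn_idPl => E; move: cop; rewrite /coprime E => ->.
Qed.

Lemma nu_ge0 z e1 e2 : 0 <= nu z e1 e2.
Proof. by rewrite /nu divr_ge0 ?ler0n ?exprn_ge0. Qed.

Lemma nu_class z e1 e2 : e1 || e2 -> nu z e1 e2 = nu z true false.
Proof. by move=> e; rewrite /nu sieved_class ?fact_gt0 ?even_fact. Qed.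

(** Both densities are compared through the primitive count on the single cell [D = 1]: sieving by
    [z] overshoots it by at most [1 / (z + 1)], and sieving by [z'] never undershoots it. *)
Lemma nu_le z z' : nu z true false - z.+1%:R^-1 <= nu z' true false.
Proof.
have h1 := @cvg_sieved 1 0 0 z true false isT isT isT.
have h2 := @cvg_sieved 1 0 0 z' true false isT isT isT.
move: h1 h2; rewrite expr1n !divr1 => h1 h2.
apply: (ler_cvg_to (cvgnB h1 (cvg_cst (z.+1%:R^-1 : R))) h2).
near=> Q.
have Q0 : 0 < Q%:R ^+ 2 :> R.
  by rewrite exprn_gt0 // ltr0n; near: Q; exact: nbhs_infty_gt.
rewrite ler_pdivlMr // mulrBl divfK ?gt_eqF // lerBlDr.
apply: le_trans (cnt_sieved_prim _ _ _ _ _ _ _) _.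
by rewrite lerD2r ler_nat cnt_prim_sieved.
Unshelve. all: by end_near. Qed.

Lemma kappa_le z : kappa <= nu z true false.
Proof.
apply: ge_inf; last by exists z.
by exists 0 => _ [y _ <-]; exact: nu_ge0.
Qed.

Lemma kappa_ge z : nu z true false - z.+1%:R^-1 <= kappa.
Proof.
apply: lb_le_inf; first by exists (nu 0 true false); exists 0%N.
by move=> _ [y _ <-]; exact: nu_le.
Qed.

(** With [z] fixed so that [1 / (z + 1) <= eps / 3], the primitive and sieved counts differ by at
    most that share of [Q ^ 2], and [nu z] is equally close to [kappa]. Only then does [Q] go to
    infinity. *)
Lemma cvg_prim_cell (D i j : nat) (e1 e2 : bool) :
  (0 < D)%N -> (i < D)%N -> (j < D)%N -> e1 || e2 ->
  ((cnt Q (fun a b => [&& cell D i Q a, cell D j Q b & prim e1 e2 a b]))%:R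
     / Q%:R ^+ 2 : R) @[Q --> \oo] --> kappa / D%:R ^+ 2.
Proof.
move=> D0 iD jD e; apply/cvgrPdist_le => eps eps0.
have [z hz] : exists z : nat, z.+1%:R^-1 <= eps / 3 :> R.
  near \oo => z; exists z.
  rewrite -[leRHS]invrK lef_pV2 ?posrE ?ltr0n ?invr_gt0 ?divr_gt0 //.
  apply: le_trans (_ : z%:R <= _); last by rewrite ler_nat.
  by near: z; exact: nbhs_infty_ger.
have e30 : 0 < eps / 3 by rewrite divr_gt0.
have := @cvg_sieved D i j z e1 e2 D0 iD jD.
move/cvgrPdist_le/(_ _ e30); rewrite nu_class // => H; near=> Q.
have Q0 : 0 < Q%:R ^+ 2 :> R.
  by rewrite exprn_gt0 // ltr0n; near: Q; exact: nbhs_infty_gt.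
have : `|nu z true false / D%:R ^+ 2 -
  (cnt Q (fun a b => [&& cell D i Q a, cell D j Q b & sieved z.+2`! e1 e2 a b]))%:R
     / Q%:R ^+ 2| <= eps / 3 by near: Q.
have h1 : (cnt Q (fun a b => [&& cell D i Q a, cell D j Q b & prim e1 e2 a b]))%:R / Q%:R ^+ 2
  <= (cnt Q (fun a b => [&& cell D i Q a, cell D j Q b & sieved z.+2`! e1 e2 a b]))%:R
     / Q%:R ^+ 2 :> R.
  by rewrite ler_pM2r ?invr_gt0 // ler_nat cnt_prim_sieved.
have h2 : (cnt Q (fun a b => [&& cell D i Q a, cell D j Q b & sieved z.+2`! e1 e2 a b]))%:R / Q%:R ^+ 2
  <= (cnt Q (fun a b => [&& cell D i Q a, cell D j Q b & prim e1 e2 a b]))%:R / Q%:R ^+ 2 + z.+1%:R^-1 :> R.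
  rewrite ler_pdivrMr // mulrDl divfK ?gt_eqF //; exact: cnt_sieved_prim.
have h3 : kappa / D%:R ^+ 2 <= nu z true false / D%:R ^+ 2.
  by rewrite ler_pM2r ?kappa_le // invr_gt0 exprn_gt0 // ltr0n.
have h4 : nu z true false / D%:R ^+ 2 <= kappa / D%:R ^+ 2 + z.+1%:R^-1.
  rewrite ler_pdivrMr ?exprn_gt0 ?ltr0n // mulrDl divfK; last first.
    by rewrite expf_eq0 /= pnatr_eq0 -lt0n.
  have := kappa_ge z; rewrite lerBlDr => /le_trans; apply; rewrite lerD2l.
  by rewrite ler_peMr ?invr_ge0 // exprn_ege1 // ler1n.
move: h1 h2 h3 h4 hz; set s := _ / Q%:R ^+ 2; set N := _ / Q%:R ^+ 2.
have -> : eps = eps / 3 + eps / 3 + eps / 3 by field.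
move: (kappa / _) (nu _ _ _ / _) s N (_^-1) (eps / 3 : R).
move=> k n s N w e3 h1 h2 h3 h4 h5; rewrite !ler_norml => /andP[h6 h7].
by apply/andP; split; lra.
Unshelve. all: by end_near. Qed.

Lemma cell1E Q a : (a <= Q)%N -> cell 1 0 Q a = (0 < a)%N.
Proof. by move=> aQ; rewrite /cell mul0n muln1 mul1n aQ andbT. Qed.

Lemma cvg_prim (e1 e2 : bool) : e1 || e2 ->
  ((cnt Q (prim e1 e2))%:R / Q%:R ^+ 2 : R) @[Q --> \oo] --> kappa.
Proof.
move=> e; have := @cvg_prim_cell 1 0 0 e1 e2 isT isT isT e.
rewrite expr1n divr1; apply: cvgn_near_eq; apply: nearW => Q.
congr (_%:R / _); apply: eq_cnt => a b aQ bQ; rewrite !cell1E //.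
by rewrite /prim; case: (0 < a)%N; case: (0 < b)%N.
Qed.

(** Every coprime pair lies in one of the three parity classes, so [3 * kappa] is at least the 1/4
    of [cnt_coprime_ge]. *)
Lemma kappa_gt0 : 0 < kappa.
Proof.
have h := cvgnD (cvgnD (@cvg_prim true false isT) (@cvg_prim false true isT))
  (@cvg_prim true true isT).
suff : 4^-1 <= kappa + kappa + kappa by lra.
apply: (ler_cvg_to (cvg_cst (4^-1 : R)) h); near=> Q.
have Q0 : 0 < Q%:R ^+ 2 :> R.
  by rewrite exprn_gt0 // ltr0n; near: Q; exact: nbhs_infty_gt.
rewrite -!mulrDl ler_pdivlMr //; apply: le_trans (cnt_coprime_ge R Q) _.
rewrite -!natrD ler_nat.
pose S := fun a b => prim true false a b || prim false true a b.
apply: (@leq_trans (cnt Q S + cnt Q (prim true true))); last first.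
  by rewrite leq_add2r; apply: cntU_le.
apply: cntU_le => a b _ _ /and3P[a0 b0 cab]; rewrite /S /prim a0 b0 cab /=.
have := coprime_odd cab.
by case: (odd a); case: (odd b).
Unshelve. all: by end_near. Qed.
End Kappa.

(** * Dyadic exhaustion of open sets *)

Section Portmanteau.
Variable R : realType.
Local Notation mu := (@lebesgue_measure R \x @lebesgue_measure R)%E.

Definition dcell (D i j : nat) : set (R * R) :=
  `]i%:R / D%:R, i.+1%:R / D%:R] `*` `]j%:R / D%:R, j.+1%:R / D%:R].

Definition ubox : set (R * R) := `]0, 1] `*` `]0, 1].

Lemma measurable_dcell D i j : measurable (dcell D i j).
Proof. by apply: measurableX; exact: measurable_itv. Qed.

Lemma measurable_ubox : measurable ubox.
Proof. by apply: measurableX; exact: measurable_itv. Qed.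

Lemma area_dcell D i j : (0 < D)%N -> mu (dcell D i j) = ((D%:R ^+ 2)^-1)%:E.
Proof.
move=> D0.
transitivity (mule (@lebesgue_measure R `]i%:R / D%:R, i.+1%:R / D%:R])
                   (@lebesgue_measure R `]j%:R / D%:R, j.+1%:R / D%:R])).
  by apply: product_measure1E; exact: measurable_itv.
have D0' : 0 < D%:R :> R by rewrite ltr0n.
rewrite !lebesgue_measure_itv /= !lte_fin !ltr_pM2r ?invr_gt0 // !ltr_nat !ltnS !leqnn.
by rewrite -!EFinB -!mulrBl -!natrB // !subSnn !mul1r -EFinM -invfM expr2.
Qed.

Lemma area_ubox : mu ubox = 1%:E.
Proof.
transitivity (mule (@lebesgue_measure R `]0, 1]) (@lebesgue_measure R `]0, 1])).
  by apply: product_measure1E; exact: measurable_itv.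
by rewrite !lebesgue_measure_itv /= !lte_fin ltr01 -!EFinB subr0 -EFinM mulr1.
Qed.

Definition inner (U : set (R * R)) (n : nat) : set (R * R) :=
  \big[setU/set0]_(p : 'I_(2 ^ n) * 'I_(2 ^ n) | `[< dcell (2 ^ n) p.1 p.2 `<=` U >])
     dcell (2 ^ n) p.1 p.2.

Lemma innerP U n x : inner U n x <->
  exists i j, [/\ (i < 2 ^ n)%N, (j < 2 ^ n)%N, dcell (2 ^ n) i j `<=` U
                & dcell (2 ^ n) i j x].
Proof.
rewrite /inner -bigcup_pred; split=> [[[i j] /= /asboolP h hx]|[i [j [hi hj h hx]]]].
  by exists i, j; split => //; exact: ltn_ord.
by exists (Ordinal hi, Ordinal hj) => //=; apply/asboolP.
Qed.

Lemma measurable_inner U n : measurable (inner U n).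
Proof. by apply: bigsetU_measurable => p _; exact: measurable_dcell. Qed.

(** Turns a lower bound on area into a lower bound on the number of cells inside [U]; finite
    subadditivity gives this direction. *)
Lemma area_inner_le U n :
  (mu (inner U n) <= ((\sum_(p : 'I_(2 ^ n) * 'I_(2 ^ n))
     `[< dcell (2 ^ n) p.1 p.2 `<=` U >])%N%:R / (2 ^ n)%:R ^+ 2)%:E)%E.
Proof.
rewrite natr_sum mulr_suml -sumEFin.
apply: (@le_trans _ _ (\sum_(p : 'I_(2 ^ n) * 'I_(2 ^ n) |
   `[< dcell (2 ^ n) p.1 p.2 `<=` U >]) mu (dcell (2 ^ n) p.1 p.2))%E).
  (* The invariant carries measurability along with the bound, since subadditivity asks for it at
     each union. *)
  pose K A (x : \bar R) := measurable A /\ (mu A <= x)%E.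
  suff: K (inner U n) (\sum_(p : 'I_(2 ^ n) * 'I_(2 ^ n) |
    `[< dcell (2 ^ n) p.1 p.2 `<=` U >]) mu (dcell (2 ^ n) p.1 p.2))%E by case.
  rewrite /inner; elim/big_rec2: _ => [|p y A _ [mA hA]].
    by split; [exact: measurable0|rewrite measure0].
  split; first by apply: measurableU => //; exact: measurable_dcell.
  apply: le_trans (measureU2 _ _ _) _ => //; first exact: measurable_dcell.
  by rewrite leeD2l.
rewrite big_mkcond /=; apply: lee_sum => p _.
by case: asboolP => _; rewrite ?area_dcell ?expn_gt0 // ?mul1r ?mul0r.
Qed.

Lemma inner_sub U n : inner U n `<=` U.
Proof. by move=> x /innerP[i [j [_ _ h /h]]]. Qed.

Lemma nat_cell (N : nat) (y : R) : 0 < y <= N%:R ->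
  exists2 i, (i < N)%N & i%:R < y <= i.+1%:R.
Proof.
elim: N => [|N IH] /andP[y0 yN]; first by move: (lt_le_trans y0 yN); rewrite ltxx.
have [yN'|Ny] := leP y N%:R; last by exists N => //; rewrite Ny.
by have [|i iN hi] := IH; [rewrite y0|exists i => //; exact: ltnW].
Qed.

(** The half that contains [x] is found by comparing [x] with the midpoint
    [(2 i + 1) / 2 ^ (n + 1)]. *)
Lemma dyadic_half (n i : nat) (x : R) : (i < 2 ^ n)%N ->
  x \in `]i%:R / (2 ^ n)%:R, i.+1%:R / (2 ^ n)%:R] ->
  exists i', [/\ (i' < 2 ^ n.+1)%N,
    x \in `]i'%:R / (2 ^ n.+1)%:R, i'.+1%:R / (2 ^ n.+1)%:R] &
    {subset `]i'%:R / (2 ^ n.+1)%:R, i'.+1%:R / (2 ^ n.+1)%:R] <=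
            `](i%:R / (2 ^ n)%:R : R), i.+1%:R / (2 ^ n)%:R]}].
Proof.
move=> iD; have D0 : 0 < (2 ^ n)%:R :> R by rewrite ltr0n expn_gt0.
rewrite expnS natrM; move: (2 ^ n)%:R D0 iD => D D0 iD.
have D20 : 0 < 2 * D by rewrite mulr_gt0.
rewrite in_itv /= ltr_pdivrMr // ler_pdivlMr // => /andP[h1 h2].
have [h|h] := leP (x * (2 * D)) (i.*2.+1)%:R.
  exists i.*2; split; first by lia.
    by rewrite in_itv /= ltr_pdivrMr // ler_pdivlMr // h andbT -muln2 natrM; nra.
  move=> y; rewrite !in_itv /= !ltr_pdivrMr // !ler_pdivlMr // -!natr1 -muln2 natrM.
  by move=> /andP[? ?]; apply/andP; split; nra.
exists i.*2.+1; split; first by lia.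
  rewrite in_itv /= ltr_pdivrMr // ler_pdivlMr // h /=.
  move: h2; rewrite -!natr1 -muln2 natrM; nra.
move=> y; rewrite !in_itv /= !ltr_pdivrMr // !ler_pdivlMr // -!natr1 -muln2 natrM.
by move=> /andP[? ?]; apply/andP; split; nra.
Qed.

Lemma inner_mono U : {homo inner U : n m / (n <= m)%N >-> (n <= m)%O}.
Proof.
apply: homo_leq => [x|y x z|n]; [exact: lexx|exact: le_trans|].
apply/subsetPset => -[x y] /innerP[i [j [hi hj h [/= hx hy]]]]; apply/innerP.
have [i' [hi' hx' si]] := dyadic_half hi hx.
have [j' [hj' hy' sj]] := dyadic_half hj hy.
exists i', j'; split => //.
by move=> [u v] [/= hu hv]; apply: h; split => /=; [exact: si|exact: sj].
Qed.

(** Once [2 ^ n] exceeds [1 / e], the cell of level [n] around a point stays within its ball of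
    radius [e]. *)
Lemma bigcup_inner U : open U -> U `<=` ubox -> \bigcup_n inner U n = U.
Proof.
move=> oU Ub; apply/seteqP; split=> [x [n _ /inner_sub//]|[x y] Uxy].
have /nbhs_ballP[e /= e0 he] : nbhs (x, y) U by exact: open_nbhs_nbhs.
near \oo => n; exists n => //.
have D0 : 0 < (2 ^ n)%:R :> R by rewrite ltr0n expn_gt0.
have hn : (2 ^ n)%:R^-1 < e.
  rewrite -[e]invrK ltf_pV2 ?posrE ?invr_gt0 //.
  apply: lt_trans (_ : n%:R < _); last by rewrite ltr_nat ltn_expl.
  by near: n; exact: nbhs_infty_gtr.
have cellx (z : R) : z \in `]0, 1] -> exists2 i, (i < 2 ^ n)%N &
    z \in `]i%:R / (2 ^ n)%:R, i.+1%:R / (2 ^ n)%:R].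
  rewrite in_itv /= => /andP[z0 z1].
  have [|i hi hz] := @nat_cell (2 ^ n) (z * (2 ^ n)%:R).
    by rewrite mulr_gt0 //= ler_piMl // ltW.
  by exists i => //; rewrite in_itv /= ltr_pdivrMr // ler_pdivlMr.
have close (i : nat) (z w : R) : z \in `]i%:R / (2 ^ n)%:R, i.+1%:R / (2 ^ n)%:R] ->
    w \in `]i%:R / (2 ^ n)%:R, i.+1%:R / (2 ^ n)%:R] -> ball z e w.
  rewrite !in_itv /= -natr1 mulrDl mul1r => /andP[? ?] /andP[? ?].
  rewrite /ball /= ltr_norml; apply/andP; split; lra.
have [/= bx by_] := Ub _ Uxy.
have [i hi hx] := cellx _ bx; have [j hj hy] := cellx _ by_.
apply/innerP; exists i, j; split => // -[u v] [/= hu hv]; apply: he.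
by split => /=; [exact: close hx hu|exact: close hy hv].
Unshelve. all: by end_near. Qed.

Lemma open_ubox_measurable U : open U -> U `<=` ubox -> measurable U.
Proof.
move=> oU Ub; rewrite -(bigcup_inner oU Ub).
by apply: bigcup_measurable => n _; exact: measurable_inner.
Qed.

(** Continuity of the measure from below along the increasing sets [inner U n]. *)
Lemma area_inner_gt (U : set (R * R)) (c : R) : open U -> U `<=` ubox -> (c%:E < mu U)%E ->
  exists n, (c%:E <= mu (inner U n))%E.
Proof.
move=> oU Ub cU.
have H : (mu \o inner U) n @[n --> \oo] --> mu (\bigcup_n inner U n).
  apply: nondecreasing_cvg_mu; [exact: measurable_inner| |exact: inner_mono].
  by apply: bigcup_measurable => n _; exact: measurable_inner.
rewrite bigcup_inner // in H.
have : \forall n \near \oo, (c%:E <= (mu \o inner U) n)%E.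
  apply: lte_lim; last 2 first.
  - by apply/cvg_ex; exists (mu U).
  - by rewrite (cvg_lim _ H).
  move=> n m nm /=; apply: le_measure; rewrite ?inE; [exact: measurable_inner..|].
  by apply/subsetPset; exact: inner_mono.
by move=> h; near \oo => n; exists n; near: n.
Unshelve. all: by end_near. Qed.

End Portmanteau.

Arguments ubox R : clear implicits.

(** * Counts in regions with negligible boundary, and the null set of integral lines *)

Section Regions.
Variable R : realType.
Local Notation mu := (@lebesgue_measure R \x @lebesgue_measure R)%E.
Local Notation kappa := (kappa R).

Definition pt (Q a b : nat) : R * R := (a%:R / Q%:R, b%:R / Q%:R).

Lemma cell_itv (D i Q a : nat) : (0 < Q)%N -> (0 < D)%N ->
  cell D i Q a = (a%:R / Q%:R \in `](i%:R / D%:R : R), i.+1%:R / D%:R]).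
Proof.
move=> Q0 D0.
have Q0' : 0 < Q%:R :> R by rewrite ltr0n.
have D0' : 0 < D%:R :> R by rewrite ltr0n.
rewrite in_itv /= ltr_pdivrMr // mulrAC ltr_pdivlMr // -!natrM ltr_nat.
by rewrite ler_pdivlMr // mulrAC ler_pdivrMr // -!natrM ler_nat.
Qed.

(** Cells of one level are disjoint, so each lattice point is counted at most once on the left. *)
Lemma cnt_cells_le (Q n : nat) (S : nat -> nat -> bool) (U : set (R * R)) : (0 < Q)%N ->
  (\sum_(p : 'I_(2 ^ n) * 'I_(2 ^ n) | `[< dcell (2 ^ n) p.1 p.2 `<=` U >])
     cnt Q (fun a b => [&& cell (2 ^ n) p.1 Q a, cell (2 ^ n) p.2 Q b & S a b])
   <= cnt Q (fun a b => S a b && `[< U (pt Q a b) >]))%N.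
Proof.
move=> Q0; rewrite /cnt exchange_big /=; apply: leq_sum => -[a b] _ /=.
have D0 : (0 < 2 ^ n)%N by rewrite expn_gt0.
have [/existsP[p /and4P[pU ca cb Sab]]|] := boolP [exists p : 'I_(2 ^ n) * 'I_(2 ^ n),
  [&& `[< dcell (2 ^ n) p.1 p.2 `<=` U >], cell (2 ^ n) p.1 Q a, cell (2 ^ n) p.2 Q b & S a b]]; last first.
  move/existsPn => h; rewrite big1 // => p pU; move: (h p); rewrite pU /=.
  by move/negbTE ->.
have -> : `[< U (pt Q a b) >].
  apply/asboolP; move/asboolP: pU; apply.
  by split; rewrite /= -cell_itv.
rewrite Sab (bigD1 p) //= ca cb big1 // => q /andP[_ qp].
apply/eqP; rewrite eqb0; apply/negP => /and3P[ca' cb' _].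
have inj (i j : 'I_(2 ^ n)) x : cell (2 ^ n) i Q x -> cell (2 ^ n) j Q x -> i = j.
  by rewrite /cell => /andP[h1 h2] /andP[h3 h4]; apply/val_inj => /=; nia.
by case/eqP: qp; rewrite [LHS]surjective_pairing [RHS]surjective_pairing
  (inj _ _ _ ca ca') (inj _ _ _ cb cb').
Qed.

Lemma cnt_open_ge (U : set (R * R)) (e1 e2 : bool) (c d : R) :
  open U -> U `<=` ubox R -> e1 || e2 -> (c%:E < mu U)%E -> d < kappa * c ->
  \forall Q \near \oo,
    d < (cnt Q (fun a b => prim e1 e2 a b && `[< U (pt Q a b) >]))%:R / Q%:R ^+ 2.
Proof.
move=> oU Ub e cU dc.
have [n cn] := area_inner_gt oU Ub cU.
have {}cn := le_trans cn (area_inner_le U n).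
rewrite lee_fin in cn.
have D0 : (0 < 2 ^ n)%N by rewrite expn_gt0.
have H : (\sum_(p : 'I_(2 ^ n) * 'I_(2 ^ n)) `[< dcell (2 ^ n) p.1 p.2 `<=` U >]%:R *
   ((cnt Q (fun a b => [&& cell (2 ^ n) p.1 Q a, cell (2 ^ n) p.2 Q b & prim e1 e2 a b]))%:R
     / Q%:R ^+ 2) : R) @[Q --> \oo] -->
   \sum_(p : 'I_(2 ^ n) * 'I_(2 ^ n)) `[< dcell (2 ^ n) p.1 p.2 `<=` U >]%:R *
     (kappa / (2 ^ n)%:R ^+ 2).
  apply: cvgn_sum => p; apply: cvgnM; first exact: cvg_cst.
  by apply: cvg_prim_cell => //; exact: ltn_ord.
have dl : d < \sum_(p : 'I_(2 ^ n) * 'I_(2 ^ n)) `[< dcell (2 ^ n) p.1 p.2 `<=` U >]%:R *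
     (kappa / (2 ^ n)%:R ^+ 2).
  apply: lt_le_trans dc _; rewrite -mulr_suml -natr_sum mulrCA.
  by rewrite ler_pM2l // kappa_gt0.
have H2 := cvgr_gt (FF := eventually_filter) _ H _ dl; near=> Q.
have Q0 : (0 < Q)%N by near: Q; exact: nbhs_infty_gt.
apply: (@lt_le_trans _ _ (\sum_(p : 'I_(2 ^ n) * 'I_(2 ^ n)) `[< dcell (2 ^ n) p.1 p.2 `<=` U >]%:R *
   ((cnt Q (fun a b => [&& cell (2 ^ n) p.1 Q a, cell (2 ^ n) p.2 Q b & prim e1 e2 a b]))%:R
     / Q%:R ^+ 2))); first by near: Q.
under eq_bigr do rewrite mulrA.
rewrite -mulr_suml ler_pM2r; last by rewrite invr_gt0 exprn_gt0 // ltr0n.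
apply: le_trans (_ : (\sum_(p : 'I_(2 ^ n) * 'I_(2 ^ n) | `[< dcell (2 ^ n) p.1 p.2 `<=` U >])
     cnt Q (fun a b => [&& cell (2 ^ n) p.1 Q a, cell (2 ^ n) p.2 Q b & prim e1 e2 a b]))%N%:R <= _).
  rewrite natr_sum [leRHS]big_mkcond /=; apply: ler_sum => p _.
  by case: asboolP; rewrite ?mul1r ?mul0r.
by rewrite ler_nat cnt_cells_le.
Unshelve. all: by end_near. Qed.

(** [U] bounds the count from below; [V], subtracted from the total [kappa], bounds it from above.
    The two bounds meet because [N] is null and hence the areas of [U] and [V] sum to at least 1. *)
Lemma cvg_cnt_region (A U V N : set (R * R)) (e1 e2 : bool) :
  e1 || e2 -> measurable A -> A `<=` ubox R -> measurable N -> mu N = 0%E ->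
  open U -> U `<=` A -> open V -> V `<=` ubox R `\` A ->
  ubox R `<=` U `|` V `|` N ->
  ((cnt Q (fun a b => prim e1 e2 a b && `[< A (pt Q a b) >]))%:R / Q%:R ^+ 2 : R)
    @[Q --> \oo] --> kappa * fine (mu A).
Proof.
move=> e mA Ab mN N0 oU UA oV VA cover.
have Ub : U `<=` ubox R by exact: subset_trans Ab.
have Vb : V `<=` ubox R by move=> x /VA[].
have mU := open_ubox_measurable oU Ub; have mV := open_ubox_measurable oV Vb.
have mB := @measurable_ubox R.
have le1 (X : set (R * R)) : measurable X -> X `<=` ubox R -> (mu X <= 1)%E.
  by move=> mX Xb; rewrite -(area_ubox R); apply: le_measure; rewrite ?inE.
have fin (X : set (R * R)) : measurable X -> X `<=` ubox R -> mu X = (fine (mu X))%:E.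
  move=> mX Xb; rewrite fineK // ge0_fin_numE ?measure_ge0 //.
  by apply: le_lt_trans (le1 _ mX Xb) _; rewrite ltry.
have h1 : fine (mu U) <= fine (mu A).
  by rewrite -lee_fin -!fin //; apply: le_measure; rewrite ?inE.
have h2 : fine (mu A) + fine (mu V) <= 1.
  rewrite -lee_fin EFinD -!fin // -measureU //; last first.
    by rewrite -subset0 => x [Ax /VA[_]].
  by apply: le1; [exact: measurableU|rewrite subUset; split].
have h3 : 1 <= fine (mu U) + fine (mu V).
  rewrite -lee_fin EFinD -!fin // -(area_ubox R).
  apply: (@le_trans _ _ (mu (U `|` V `|` N))).
    by apply: le_measure; rewrite ?inE //; do !apply: measurableU.
  rewrite measureU0 //; last exact: measurableU.
  exact: measureU2.
have k0 := kappa_gt0 R.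
set a := fine (mu A); apply/cvgrPdist_le => eps eps0.
(* Error budget in units of [kappa * t]: two for each of the lower bounds on [U] and [V], one for
   the total count. The worst case, three, stays below [eps], which is four. *)
pose t : R := eps / kappa / 4.
have t0 : 0 < t by rewrite !divr_gt0.
have et : eps = 4 * (kappa * t) by rewrite /t; field; rewrite gt_eqF.
have kt0 : 0 < kappa * t by rewrite mulr_gt0.
have hU : ((a - t)%:E < mu U)%E by rewrite fin // lte_fin /a; lra.
have hV : ((1 - a - t)%:E < mu V)%E by rewrite fin // lte_fin /a; lra.
have dU : kappa * a - 2 * (kappa * t) < kappa * (a - t) by lra.
have dV : kappa * (1 - a) - 2 * (kappa * t) < kappa * (1 - a - t) by lra.
have HU := cnt_open_ge oU Ub e hU dU.
have HV := cnt_open_ge oV Vb e hV dV.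
have kk : kappa < kappa + kappa * t by lra.
have HP := cvgr_lt (FF := eventually_filter) _ (@cvg_prim R e1 e2 e) _ kk.
near=> Q.
have Q0 : 0 < Q%:R ^+ 2 :> R.
  by rewrite exprn_gt0 // ltr0n; near: Q; exact: nbhs_infty_gt.
have q1 : kappa * a - 2 * (kappa * t) <
    (cnt Q (fun a b => prim e1 e2 a b && `[< U (pt Q a b) >]))%:R / Q%:R ^+ 2 by near: Q.
have q2 : kappa * (1 - a) - 2 * (kappa * t) <
    (cnt Q (fun a b => prim e1 e2 a b && `[< V (pt Q a b) >]))%:R / Q%:R ^+ 2 by near: Q.
have q3 : (cnt Q (prim e1 e2))%:R / Q%:R ^+ 2 < kappa + kappa * t by near: Q.
have r1 : (cnt Q (fun a b => prim e1 e2 a b && `[< U (pt Q a b) >]))%:R / Q%:R ^+ 2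
  <= (cnt Q (fun a b => prim e1 e2 a b && `[< A (pt Q a b) >]))%:R / Q%:R ^+ 2 :> R.
  rewrite ler_pM2r ?invr_gt0 // ler_nat; apply: cnt_le => x y _ _ /andP[->] /=.
  by move=> /asboolP /UA ?; apply/asboolP.
have r2 : (cnt Q (fun a b => prim e1 e2 a b && `[< A (pt Q a b) >]))%:R / Q%:R ^+ 2 +
  (cnt Q (fun a b => prim e1 e2 a b && `[< V (pt Q a b) >]))%:R / Q%:R ^+ 2
  <= (cnt Q (prim e1 e2))%:R / Q%:R ^+ 2 :> R.
  rewrite -mulrDl ler_pM2r ?invr_gt0 // -natrD ler_nat.
  rewrite (cnt_split Q (prim e1 e2) (fun x y => `[< A (pt Q x y) >])) leq_add2l.
  apply: cnt_le => x y _ _ /andP[->] /= /asboolP /VA [_ nA].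
  by apply/negP => /asboolP.
move: q1 q2 q3 r1 r2; rewrite et ler_norml.
move: (_ / Q%:R ^+ 2) (_ / Q%:R ^+ 2) (_ / Q%:R ^+ 2) (_ / Q%:R ^+ 2) => u v p w.
by move=> q1 q2 q3 r1 r2; apply/andP; split; lra.
Unshelve. all: by end_near. Qed.

Definition line (a b : int) : set (R * R) := [set p | a%:~R * p.1 + b%:~R * p.2 = 1].

Lemma measurable_lin (a b : R) : measurable_fun setT (fun p : R * R => a * p.1 + b * p.2).
Proof.
apply: measurable_realfun.measurable_funD; apply: measurable_realfun.measurable_funM => //; exact: measurable_cst.
Qed.

Lemma measurable_line a b : measurable (line a b).
Proof.
have := @measurable_lin a%:~R b%:~R measurableT [set 1] (measurable_set1 _).
by rewrite setTI.
Qed.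

(** For nonzero [b] every section at fixed abscissa has at most one point; for [b = 0] the line is
    vertical, or empty if [a = 0] as well. *)
Lemma area_line a b : mu (line a b) = 0%E.
Proof.
have [b0|b0] := eqVneq b 0; last first.
  have b0' : b%:~R != 0 :> R by rewrite intr_eq0.
  rewrite [LHS]/product_measure1 /= integral0_eq // => x _ /=.
  apply/eqP; rewrite eq_le measure_ge0 andbT -(lebesgue_measure_set1 ((1 - a%:~R * x) / b%:~R)).
  apply: le_measure; rewrite ?inE; [|exact: measurable_set1|].
    by apply: measurable_xsection; exact: measurable_line.
  move=> y; rewrite /xsection /= inE /line /= => h.
  have -> : 1 - a%:~R * x = b%:~R * y by rewrite -[X in X - _]h addrAC subrr add0r.
  by rewrite mulrAC mulfV // mul1r.
have [a0|a0] := eqVneq a 0.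
  rewrite (_ : line a b = set0) ?measure0 // -subset0 => -[x y].
  by rewrite /line /= a0 b0 !mul0r addr0 => /esym/eqP; rewrite oner_eq0.
have a0' : a%:~R != 0 :> R by rewrite intr_eq0.
rewrite (_ : line a b = [set a%:~R^-1] `*` setT); last first.
  apply/seteqP; split=> -[x y]; rewrite /line /= b0 mul0r addr0.
    by move=> h; split => //; apply: (mulfI a0'); rewrite h mulfV.
  by move=> [-> _]; rewrite mulfV.
transitivity (mule (@lebesgue_measure R [set a%:~R^-1]) (@lebesgue_measure R setT)).
  by apply: product_measure1E => //; exact: measurable_set1.
by rewrite lebesgue_measure_set1 mul0e.
Qed.

(** Indexed by the codes of integer pairs, so that countable subadditivity over [nat] applies;
    numbers that code no pair contribute the empty set. *)
Definition lines : set (R * R) := \bigcup_n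
  (if @unpickle (int * int)%type n is Some ab then line ab.1 ab.2 else set0).

Lemma linesP a b p : a%:~R * p.1 + b%:~R * p.2 = 1 -> lines p.
Proof. by move=> h; exists (pickle (a, b)) => //; rewrite pickleK. Qed.

Lemma measurable_lines : measurable lines.
Proof.
by apply: bigcup_measurable => n _; case: unpickle => // -[a b]; exact: measurable_line.
Qed.

Lemma area_lines : mu lines = 0%E.
Proof.
apply/eqP; rewrite eq_le measure_ge0 andbT.
pose F n := if @unpickle (int * int)%type n is Some ab then line ab.1 ab.2 else set0.
have mF n : measurable (F n).
  by rewrite /F; case: unpickle => // -[a b]; exact: measurable_line.
apply: le_trans (measure_sigma_subadditive mu mF measurable_lines _) _ => //.
rewrite eseries0 // => n _ _; rewrite /F; case: unpickle => [[a b]|].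
  exact: area_line.
exact: measure0.
Qed.
End Regions.

Arguments lines R : clear implicits.

(** * The polygons T[k] *)

(* Coefficients of the linear forms L_{n-1} on a cell T[k]. *)
Fixpoint lform (k : nat -> nat) (n : nat) : int * int :=
  match n with
  | 0 => (1, 0)
  | n1.+1 =>
    match n1 with
    | 0 => (0, 1)
    | n2.+1 => ((k n2)%:Z * (lform k n1).1 - (lform k n2).1,
                (k n2)%:Z * (lform k n1).2 - (lform k n2).2)
    end
  end.

Section Geometry.
Variable R : realType.
Implicit Types (p : R * R) (k : nat -> nat).
Local Notation mu := (@lebesgue_measure R \x @lebesgue_measure R)%E.

Definition lin (c : int * int) (p : R * R) : R := c.1%:~R * p.1 + c.2%:~R * p.2.

Lemma lin_lform k n p :
  lin (lform k n.+2) p = (k n)%:R * lin (lform k n.+1) p - lin (lform k n) p.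
Proof.
rewrite /lin [lform k n.+2]/= !rmorphB !rmorphM /=.
by rewrite -!(pmulrn _ (k n)); ring.
Qed.

(** The two inequalities defining the floor are exactly [w <= 1] and [1 < v + w]: the triangle is
    stable under the map producing the [Lseq]. *)
Lemma floor_step (u v : R) : fareyT (u, v) ->
  let w := (Num.floor ((1 + u) / v))%:~R * v - u in fareyT (v, w).
Proof.
move=> [/= /andP[u0 u1] /andP[v0 v1] uv].
set f := Num.floor _; have := floor_itv ((1 + u) / v); rewrite -/f.
rewrite ler_pdivlMr // ltr_pdivrMr // intrD => /andP[h1 h2].
by split => /=; [rewrite v0|apply/andP; split|]; lra.
Qed.

Lemma LseqSS (p : R * R) n :
  Lseq p n.+2 = (kidx p n)%:~R * Lseq p n.+1 - Lseq p n.
Proof. by []. Qed.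

Lemma Lseq_fareyT p n : fareyT p -> fareyT (Lseq p n, Lseq p n.+1).
Proof.
move=> Tp; elim: n => [|n IH]; first by case: p Tp.
by have := floor_step IH.
Qed.

Lemma kidxP p n (m : nat) : fareyT p ->
  kidx p n = m%:Z <->
  m%:R * Lseq p n.+1 - Lseq p n <= 1 /\
  1 < Lseq p n.+1 + (m%:R * Lseq p n.+1 - Lseq p n).
Proof.
move=> /(Lseq_fareyT n); rewrite /kidx; move: (Lseq p n) (Lseq p n.+1) => u v.
move=> [/= /andP[u0 u1] /andP[v0 v1] uv]; split=> [/eqP|[h1 h2]].
  rewrite floor_eq ler_pdivlMr // ltr_pdivrMr // intrD -!pmulrn => /andP[h1 h2].
  by split; lra.
apply/eqP; rewrite floor_eq ler_pdivlMr // ltr_pdivrMr // intrD -!pmulrn.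
by apply/andP; split; lra.
Qed.

(** The cell [T[k]] as a polygon cut out by integral linear forms. Here [k] is a function, so that
    [s] can vary in inductions. *)
Definition kcell k (s : nat) : set (R * R) :=
  [set p | fareyT p /\ forall j, (j < s)%N ->
     lin (lform k j.+2) p <= 1 /\ 1 < lin (lform k j.+1) p + lin (lform k j.+2) p].

Lemma lin_Lseq k s p : (forall j, (j < s)%N -> kidx p j = (k j)%:Z) ->
  forall n, (n <= s)%N ->
  Lseq p n = lin (lform k n) p /\ Lseq p n.+1 = lin (lform k n.+1) p.
Proof.
move=> h; elim=> [|n IH] ns.
  by rewrite /lin /= !mul0r !mul1r addr0 add0r.
have [e1 e2] := IH (ltnW ns); split => //.
by rewrite LseqSS (h n ns) lin_lform e1 e2 -pmulrn.
Qed.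

Lemma kcellP k s p : kcell k s p <->
  fareyT p /\ forall j, (j < s)%N -> kidx p j = (k j)%:Z.
Proof.
split=> -[Tp h]; split => //.
  (* Strong induction: [lform] computes [Lseq] up to step [j] only once all the earlier indices are
     known to agree with [k]. *)
  move=> j; have [m jm] := ubnP j; elim: m j jm => // m IH j jm js.
  have IH' i : (i < j)%N -> kidx p i = (k i)%:Z.
    by move=> ij; apply: IH; [exact: leq_trans ij _|exact: ltn_trans js].
  have [e1 e2] := lin_Lseq IH' (leqnn j).
  have := h j js; rewrite lin_lform -e1 -e2 => h'.
  by apply/kidxP.
move=> j js.
have IH' i : (i < j)%N -> kidx p i = (k i)%:Z.
  by move=> ij; apply: h; exact: ltn_trans js.
have [e1 e2] := lin_Lseq IH' (leqnn j).
by rewrite lin_lform -e1 -e2; apply/kidxP => //; exact: h.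
Qed.

Lemma fareyTkE s (k : s.-tuple nat) : fareyTk R k = kcell (nth 0%N k) s.
Proof.
apply/seteqP; split=> p.
  move=> [Tp h]; apply/kcellP; split => // j js.
  by rewrite (h (Ordinal js)) (tnth_nth 0%N).
move/kcellP => [Tp h]; split => // j.
by rewrite (tnth_nth 0%N) h.
Qed.

Lemma measurable_lin_gt (c : int * int) : measurable [set p : R * R | 1 < lin c p].
Proof.
have := @measurable_lin R c.1%:~R c.2%:~R measurableT [set` `]1, +oo[]%R
  (measurable_itv _).
rewrite setTI; congr measurable; apply/seteqP; split=> p /=; by rewrite in_itv /= andbT.
Qed.

Lemma linD (c d : int * int) p : lin c p + lin d p = lin (c.1 + d.1, c.2 + d.2) p.
Proof. by rewrite /lin /= !intrD; ring. Qed.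

Lemma fareyTE : @fareyT R = ubox R `&` [set p | 1 < lin (1, 1) p].
Proof.
apply/seteqP; split=> p; rewrite /ubox /lin /= !mul1r !in_itv /=.
  by move=> [? ? ?]; split.
by move=> [[? ?] ?]; split.
Qed.

Lemma measurable_kcell k s : measurable (kcell k s).
Proof.
elim: s => [|s IH].
  rewrite (_ : kcell k 0 = @fareyT R); last by apply/seteqP; split=> p // [].
  rewrite fareyTE; apply: measurableI; first exact: measurable_ubox.
  exact: measurable_lin_gt.
rewrite (_ : kcell k s.+1 = kcell k s `&` (~` [set p | 1 < lin (lform k s.+2) p] `&`
   [set p | 1 < lin ((lform k s.+1).1 + (lform k s.+2).1,
                     (lform k s.+1).2 + (lform k s.+2).2) p])).
  apply: measurableI => //; apply: measurableI; last exact: measurable_lin_gt.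
  by apply: measurableC; exact: measurable_lin_gt.
apply/seteqP; split=> p.
  move=> [Tp h]; split; first by split => // j js; apply: h; exact: ltnW.
  have [h1 h2] := h s (ltnSn s); split; last by rewrite /mkset -linD.
  by apply/negP; rewrite -leNgt.
move=> [[Tp h] [/negP h1 h2]]; split => // j; rewrite ltnS leq_eqVlt => /orP[/eqP ->|/h//].
by rewrite linD leNgt.
Qed.

(** [kcell] with its weak inequalities made strict: an open set that misses only points lying on
    [lines]. *)
Definition okcell k (s : nat) : set (R * R) :=
  [set p | [/\ 0 < p.1 < 1, 0 < p.2 < 1 & 1 < p.1 + p.2] /\ forall j, (j < s)%N ->
     lin (lform k j.+2) p < 1 /\ 1 < lin (lform k j.+1) p + lin (lform k j.+2) p].

Lemma okcell_sub k s : okcell k s `<=` kcell k s.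
Proof.
move=> p [[/andP[a b] /andP[c d] e] h]; split.
  by split => //; rewrite ?a ?c ltW.
by move=> j /h [/ltW].
Qed.

Lemma continuous_aff (a b : R) : continuous (fun p : R * R => a * p.1 + b * p.2).
Proof.
move=> p; apply: cvgD; apply: cvgM; try exact: cvg_cst.
  exact: cvg_fst.
exact: cvg_snd.
Qed.

Lemma open_aff_gt (a b c : R) : open [set p : R * R | c < a * p.1 + b * p.2].
Proof.
have := @open_comp _ _ (fun p : R * R => a * p.1 + b * p.2) [set x | c < x]
  (fun p _ => @continuous_aff a b p) (@open_gt _ c); exact.
Qed.

Lemma open_aff_lt (a b c : R) : open [set p : R * R | a * p.1 + b * p.2 < c].
Proof.
have := @open_comp _ _ (fun p : R * R => a * p.1 + b * p.2) [set x | x < c]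
  (fun p _ => @continuous_aff a b p) (@open_lt _ c); exact.
Qed.

Lemma open_okcell k s : open (okcell k s).
Proof.
elim: s => [|s IH].
  rewrite (_ : okcell k 0 = [set p | 0 < 1 * p.1 + 0 * p.2] `&` [set p | 1 * p.1 + 0 * p.2 < 1]
    `&` [set p | 0 < 0 * p.1 + 1 * p.2] `&` [set p | 0 * p.1 + 1 * p.2 < 1]
    `&` [set p | 1 < 1 * p.1 + 1 * p.2]).
    by do !apply: openI; try exact: open_aff_gt; exact: open_aff_lt.
  apply/seteqP; split=> p /=; rewrite !mul0r !mul1r addr0 add0r.
    by move=> [[/andP[? ?] /andP[? ?] ?] _].
  by move=> [[[[a b] c] d] e]; split => //; rewrite a b c d e.
rewrite (_ : okcell k s.+1 = okcell k s `&` ([set p | lin (lform k s.+2) p < 1] `&`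
   [set p | 1 < lin ((lform k s.+1).1 + (lform k s.+2).1,
                     (lform k s.+1).2 + (lform k s.+2).2) p])).
  by apply: openI => //; apply: openI; [exact: open_aff_lt|exact: open_aff_gt].
apply/seteqP; split=> p.
  move=> [Tp h]; split; first by split => // j js; apply: h; exact: ltnW.
  by have [h1 h2] := h s (ltnSn s); split => //; rewrite /mkset -linD.
move=> [[Tp h] [h1 h2]]; split => // j; rewrite ltnS leq_eqVlt => /orP[/eqP ->|/h//].
by rewrite linD.
Qed.

(** Each weak inequality of [kcell], including the two bounds of the unit square, reads
    [lin c p <= 1] with integral [c]; equality would put [p] on one of the [lines]. *)
Lemma kcell_okcell k s p : kcell k s p -> ~ lines R p -> okcell k s p.
Proof.
move=> [[/andP[a b] /andP[c d] e] h] nl.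
have ne c' : lin c' p != 1.
  by apply/eqP => hl; apply: nl; exact: linesP hl.
split; last by move=> j /h[h1 h2]; rewrite lt_neqAle ne.
split => //; rewrite ?a ?c /= lt_neqAle ?b ?d andbT.
  by have := ne (1, 0); rewrite /lin /= mul1r mul0r addr0.
by have := ne (0, 1); rewrite /lin /= mul1r mul0r add0r.
Qed.

End Geometry.

(** * Integral points of the dilated Farey triangle *)

Definition latT (Q a b : nat) : bool :=
  [&& 0 < a, a <= Q, 0 < b, b <= Q & Q < a + b]%N.

Lemma qseqSS Q a b n :
  qseq Q a b n.+2 = (kseq Q a b n * qseq Q a b n.+1 - qseq Q a b n)%N.
Proof. by []. Qed.

(** Integer counterpart of [floor_step]. The second conjunct records that the truncated subtraction
    is exact. *)
Lemma latT_step Q u v : latT Q u v ->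
  let w := ((Q + u) %/ v * v - u)%N in latT Q v w /\ (w + u = (Q + u) %/ v * v)%N.
Proof.
move=> /and5P[u0 uQ v0 vQ uv] w.
have h1 := leq_trunc_div (Q + u) v; have h2 := ltn_ceil (Q + u) v0.
by rewrite /latT /w; move: h1 h2; rewrite mulSn; move: (_ %/ _ * v)%N => t; lia.
Qed.

Lemma latT_qseq Q a b n : latT Q a b -> latT Q (qseq Q a b n) (qseq Q a b n.+1).
Proof. by move=> h; elim: n => [|n IH] //; have [] := latT_step IH. Qed.

Lemma qseq_rec Q a b n : latT Q a b ->
  (qseq Q a b n.+2 + qseq Q a b n = kseq Q a b n * qseq Q a b n.+1)%N.
Proof. by move=> /(latT_qseq n) /latT_step[_]. Qed.

Lemma kseq_gt0 Q a b n : latT Q a b -> (0 < kseq Q a b n)%N.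
Proof.
move=> /(latT_qseq n) /and5P[_ _ v0 vQ _].
by rewrite divn_gt0 // (leq_trans vQ) ?leq_addr.
Qed.

Definition kvec (s Q a b : nat) : s.-tuple nat := [tuple kseq Q a b i | i < s].

Section Lattice.
Variable R : realType.
Local Notation mu := (@lebesgue_measure R \x @lebesgue_measure R)%E.

Lemma fareyT_pt Q a b : (0 < Q)%N -> fareyT (pt R Q a b) <-> latT Q a b.
Proof.
move=> Q0; have Q0' : 0 < Q%:R :> R by rewrite ltr0n.
rewrite /fareyT /latT /= -mulrDl -natrD !pmulr_lgt0 ?invr_gt0 // !ltr0n.
rewrite !ler_pdivrMr // !ltr_pdivlMr // !mul1r !ler_nat !ltr_nat.
by split=> [[/andP[-> ->] /andP[-> ->] ->]//|/and5P[-> -> -> -> ->]].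
Qed.

Lemma floor_divn (Q u v : nat) : (0 < Q)%N -> (0 < v)%N ->
  Num.floor ((1 + u%:R / Q%:R) / (v%:R / Q%:R) : R) = ((Q + u) %/ v)%N%:Z.
Proof.
move=> Q0 v0; have Q0' : 0 < Q%:R :> R by rewrite ltr0n.
have v0' : 0 < v%:R :> R by rewrite ltr0n.
have -> : (1 + u%:R / Q%:R) / (v%:R / Q%:R) = (Q + u)%:R / v%:R :> R.
  by rewrite natrD; field; rewrite !gt_eqF.
apply/eqP; rewrite floor_eq ler_pdivlMr // ltr_pdivrMr // intrD -!pmulrn.
rewrite -natrD -!natrM ler_nat ltr_nat leq_trunc_div /= addn1; exact: ltn_ceil.
Qed.

Lemma Lseq_pt Q a b n : latT Q a b ->
  Lseq (pt R Q a b) n = (qseq Q a b n)%:R / Q%:R /\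
  Lseq (pt R Q a b) n.+1 = (qseq Q a b n.+1)%:R / Q%:R.
Proof.
move=> h; have Q0 : (0 < Q)%N by case/and5P: h => a0 aQ _ _ _; exact: leq_trans aQ.
elim: n => [|n [e1 e2]]; first by [].
split=> //; rewrite LseqSS /kidx e1 e2 floor_divn //; last first.
  by case/and5P: (latT_qseq n h).
have := congr1 (fun x : nat => x%:R : R) (qseq_rec n h).
rewrite natrD natrM /kseq -pmulrn => /(canRL (addrK _)) ->.
by rewrite mulrBl mulrA.
Qed.

Lemma kidx_pt Q a b n : latT Q a b -> kidx (pt R Q a b) n = (kseq Q a b n)%:Z.
Proof.
move=> h; have Q0 : (0 < Q)%N by case/and5P: h => a0 aQ _ _ _; exact: leq_trans aQ.
have [e1 e2] := Lseq_pt n h; rewrite /kidx e1 e2 floor_divn //.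
by case/and5P: (latT_qseq n h).
Qed.

Definition region s (P : set (s.-tuple nat)) : set (R * R) :=
  \bigcup_(k in P) fareyTk R k.

Lemma region_pt s (P : set (s.-tuple nat)) Q a b : (0 < Q)%N ->
  region P (pt R Q a b) <-> latT Q a b /\ P (kvec s Q a b).
Proof.
move=> Q0; split=> [[k Pk [/(fareyT_pt _ _ Q0) h hk]]|[h Pk]].
  split=> //; rewrite (_ : kvec s Q a b = k) //; apply: eq_from_tnth => j.
  by rewrite tnth_mktuple; apply/eqP; rewrite -eqz_nat -hk kidx_pt.
exists (kvec s Q a b) => //; split=> [|j]; first exact/fareyT_pt.
by rewrite tnth_mktuple kidx_pt.
Qed.

Lemma fareyTk_inj s (k k' : s.-tuple nat) p : fareyTk R k p -> fareyTk R k' p -> k = k'.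
Proof.
move=> [_ h] [_ h']; apply: eq_from_tnth => j.
by apply/eqP; rewrite -eqz_nat -h h'.
Qed.

Lemma measurable_fareyTk s (k : s.-tuple nat) : measurable (fareyTk R k).
Proof. by rewrite fareyTkE; exact: measurable_kcell. Qed.

Lemma measurable_region s (P : set (s.-tuple nat)) : measurable (region P).
Proof.
rewrite /region bigcup_mkcond; apply: countable_bigcupT_measurable.
  exact: countableP.
by move=> k; case: ifP => // _; exact: measurable_fareyTk.
Qed.

(** The cells are pairwise disjoint, a point determining its own indices. Tuples are enumerated
    through [pickle] to use countable additivity over [nat]. *)
Lemma area_region s (P : set (s.-tuple nat)) :
  mu (region P) = (\esum_(k in P) mu (fareyTk R k))%E.
Proof.
pose F n := if @pickle_inv (s.-tuple nat) n is Some k then fareyTk R k else set0.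
have FE k : F (@pickle (s.-tuple nat) k) = fareyTk R k by rewrite /F (@pickleK_inv (s.-tuple nat)).
have mF n : measurable (F n).
  by rewrite /F; case: pickle_inv => // k; exact: measurable_fareyTk.
rewrite (_ : region P = \bigcup_(n in @pickle (s.-tuple nat) @` P) F n); last first.
  by rewrite bigcup_image; apply: eq_bigcupr => k _; rewrite FE.
have tF : trivIset (@pickle (s.-tuple nat) @` P) F.
  move=> _ _ [k _ <-] [k' _ <-]; rewrite !FE => -[p [hk hk']].
  by rewrite (fareyTk_inj hk hk').
have -> : mu (\bigcup_(n in @pickle (s.-tuple nat) @` P) F n) =
    (\sum_(0 <= n <oo | n \in @pickle (s.-tuple nat) @` P) mu (F n))%E.
  by apply: measure_bigcup => // n _; exact: mF.
rewrite nneseries_esum; last by move=> n _; exact: measure_ge0.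
rewrite set_mem_set esum_image; last by move=> x y _ _; exact: (pcan_inj pickleK).
by apply: eq_esum => k _; rewrite FE.
Qed.

Lemma region_sub s (P : set (s.-tuple nat)) : region P `<=` ubox R.
Proof. by move=> p [k _ [+ _]]; rewrite fareyTE => -[]. Qed.

Lemma kidx_nat (p : R * R) n : fareyT p -> exists m : nat, kidx p n = m%:Z.
Proof.
move=> /(Lseq_fareyT n) [/= /andP[u0 _] /andP[v0 _] _].
have : 0 <= kidx p n.
  rewrite /kidx floor_ge0 divr_ge0 //; last exact: ltW.
  by rewrite addr_ge0 // ltW.
by case: (kidx p n) => // m _; exists m.
Qed.

Lemma fareyT_region s (p : R * R) : fareyT p -> exists k : s.-tuple nat, fareyTk R k p.
Proof.
move=> Tp; exists [tuple `|kidx p i|%N | i < s]; split=> // j.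
by rewrite tnth_mktuple; have [m ->] := kidx_nat j Tp.
Qed.

(** [cvg_cnt_region] applies with [U] the open cells for [k] in [P], and [V] the open cells for the
    other [k] together with the open triangle [W] below the diagonal [x + y = 1]. *)
Lemma cvg_cnt_lattice s (P : set (s.-tuple nat)) (e1 e2 : bool) : e1 || e2 ->
  ((cnt Q (fun a b => [&& prim e1 e2 a b, latT Q a b & `[< P (kvec s Q a b) >]]))%:R
     / Q%:R ^+ 2 : R) @[Q --> \oo] --> kappa R * fine (mu (region P)).
Proof.
move=> e.
pose U := \bigcup_(k in P) @okcell R (nth 0%N k) s.
pose W : set (R * R) := [set p | 0 < 1 * p.1 + 0 * p.2] `&` [set p | 0 < 0 * p.1 + 1 * p.2]
  `&` [set p | 1 * p.1 + 1 * p.2 < 1].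
pose V := W `|` \bigcup_(k in ~` P) @okcell R (nth 0%N k) s.
have okT (k : s.-tuple nat) p : @okcell R (nth 0%N k) s p -> fareyTk R k p.
  by rewrite fareyTkE; exact: okcell_sub.
have := @cvg_cnt_region R (region P) U V (lines R) e1 e2 e (@measurable_region s P)
  (@region_sub s P) (@measurable_lines R) (@area_lines R).
move=> H; apply: cvgn_near_eq (H _ _ _ _ _).
- near=> Q; have Q0 : (0 < Q)%N by near: Q; exact: nbhs_infty_gt.
  congr (_%:R / _); apply: eq_cnt => a b _ _; congr andb.
  apply/asboolP/andP => [/(region_pt _ _ _ Q0)[-> ?]|[? /asboolP ?]].
    by split=> //; apply/asboolP.
  exact/region_pt.
- by apply: bigcup_open => k _; exact: open_okcell.
- by move=> p [k Pk /okT]; exists k.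
- apply: openU; last by apply: bigcup_open => k _; exact: open_okcell.
  by do !apply: openI; try exact: open_aff_gt; exact: open_aff_lt.
- move=> p [|[k nPk /okT hk]].
    move=> [[]] /=; rewrite !mul1r !mul0r addr0 add0r => x0 y0 xy; split.
      by split; rewrite /= in_itv /=; apply/andP; split=> //; lra.
    by move=> [k _ [[_ _]]]; lra.
  split; first by case: hk; rewrite fareyTE => -[].
  by move=> [k' Pk' hk']; apply: nPk; rewrite (fareyTk_inj hk hk').
- move=> p pb; have [lp|nlp] := pselect (lines R p); first by right.
  left; have [xy|] := ltP 1 (p.1 + p.2).
    have Tp : fareyT p by rewrite fareyTE; split=> //; rewrite /lin /= !mul1r.
    have [k hk] := @fareyT_region s p Tp.
    have ok : @okcell R (nth 0%N k) s p by apply: kcell_okcell => //; rewrite -fareyTkE.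
    by have [Pk|nPk] := pselect (P k); [left|right; right]; exists k.
  rewrite le_eqVlt => /orP[/eqP h|h].
    (* The diagonal itself is one of the integral lines. *)
    by case: nlp; apply: (@linesP _ 1 1); rewrite !mul1r.
  right; left; case: pb => /=; rewrite !in_itv /= => /andP[x0 _] /andP[y0 _].
  by split; [split|]; rewrite /= ?mul1r ?mul0r ?addr0 ?add0r.
Unshelve. all: by end_near. Qed.
End Lattice.

Arguments region R {s} P.

(** * Area of the Farey triangle *)

Section AreaT.
Variable R : realType.
Local Notation mu := (@lebesgue_measure R \x @lebesgue_measure R)%E.

Lemma integral_id01 : (\int[@lebesgue_measure R]_(x in `[0%R, 1%R]) x%:E = (2^-1)%:E)%E.
Proof.
pose F (x : R) := x ^+ 2 / 2.
have dF (x : R) : is_derive x 1 F x.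
  by apply: is_derive_eq; rewrite /GRing.scale /=; field.
rewrite (@continuous_FTC2 R id F).
- by rewrite /F expr1n expr0n mul0r sube0 mul1r.
- exact: ltr01.
- by apply: continuous_subspaceT => x; exact: cvg_id.
- have cF : continuous F.
    move=> x; apply: differentiable_continuous; apply/derivable1_diffP; exact: ex_derive.
  split=> [x _||]; first exact: ex_derive.
    by apply: cvg_at_right_filter; exact: cF.
  by apply: cvg_at_left_filter; exact: cF.
- by move=> x _; rewrite derive1E; exact: derive_val.
Qed.

Lemma measure_xsection_fareyT (x : R) : 0 < x <= 1 ->
  @lebesgue_measure R (xsection (@fareyT R) x) = x%:E.
Proof.
move=> /andP[x0 x1].
have -> : xsection (@fareyT R) x = [set` `]1 - x, 1]%R].
  apply/seteqP; split=> y; rewrite /xsection /= inE /fareyT /= in_itv /=.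
    by move=> [_ /andP[_ ->] h]; rewrite andbT; lra.
  by move=> /andP[h1 h2]; split; [rewrite x0 x1|rewrite h2 andbT|]; lra.
rewrite lebesgue_measure_itv /= lte_fin ifT; last by lra.
by rewrite -EFinB; congr EFin; lra.
Qed.

(** The section at abscissa [x] is an interval of length [x], and the integral of [x] over the unit
    interval is 1/2. *)
Lemma area_fareyT : mu (@fareyT R) = (2^-1)%:E.
Proof.
rewrite -integral_id01 -integral_itv_obnd_cbnd; last exact/measurable_realfun.measurable_EFinP/measurable_id.
rewrite [LHS]/product_measure1 [RHS]integral_mkcond; apply: eq_integral => x _ /=.
rewrite patchE; case: ifPn => [|xn].
  rewrite inE /= in_itv /=; exact: measure_xsection_fareyT.
rewrite (_ : xsection (@fareyT R) x = set0) ?measure0 // -subset0 => y.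
rewrite /xsection /= inE => -[/= h _ _].
by case/negP: xn; rewrite inE /= in_itv.
Qed.
End AreaT.

(** * Neighbours in the Farey sequence *)

Definition qfrac (a q : nat) : rat := a%:R / q%:R.

Lemma qfrac_lt a q b d : (0 < q)%N -> (0 < d)%N ->
  (qfrac a q < qfrac b d) = (a * d < b * q)%N.
Proof.
move=> q0 d0; rewrite /qfrac ltr_pdivrMr ?ltr0n // mulrAC ltr_pdivlMr ?ltr0n //.
by rewrite -!natrM ltr_nat.
Qed.

Lemma denq_qfrac a q : (0 < q)%N -> coprime a q -> `|denq (qfrac a q)|%N = q.
Proof.
move=> q0 aq; rewrite /qfrac !pmulrn coprimeq_den /= ?absz_nat //.
by rewrite ifF //; apply/negbTE; rewrite -lt0n.
Qed.

Lemma numq_qfrac a q : (0 < q)%N -> coprime a q -> `|numq (qfrac a q)|%N = a.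
Proof.
move=> q0 aq; rewrite /qfrac !pmulrn coprimeq_num /= ?absz_nat //.
by rewrite gtr0_sg ?mul1r.
Qed.

Lemma mem_farey Q x : reflect
  (exists a q, [/\ (0 < q <= Q)%N, (a <= q)%N, coprime a q & x = qfrac a q])
  (x \in farey Q).
Proof.
rewrite mem_sort; apply: (iffP allpairsPdep) => [[q [a [hq ha ->]]]|[a [q [hq aq cop ->]]]].
  move: hq ha; rewrite mem_iota add1n ltnS mem_filter mem_iota add0n ltnS /=.
  by move=> hq /andP[? ?]; exists a, q.
by exists q, a; split => //; rewrite ?mem_filter ?mem_iota ?add1n ?ltnS //= cop.
Qed.

Lemma farey_uniq Q : uniq (farey Q).
Proof.
rewrite sort_uniq; apply: allpairs_uniq_dep => [|q _|]; first exact: iota_uniq.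
  by rewrite filter_uniq // iota_uniq.
move=> _ _ /allpairsPdep[q [a [hq ha ->]]] /allpairsPdep[q' [a' [hq' ha' ->]]] /=.
move: hq ha hq' ha'; rewrite !mem_iota !mem_filter => /andP[q0 _] /andP[c _] /andP[q0' _] /andP[c' _] e.
have qq : q = q' by rewrite -(denq_qfrac q0 c) -(denq_qfrac q0' c') /qfrac e.
have aa : a = a' by rewrite -(numq_qfrac q0 c) -(numq_qfrac q0' c') /qfrac e.
by rewrite qq aa.
Qed.

Lemma farey_sorted Q : sorted <%R (farey Q).
Proof. by rewrite lt_sorted_uniq_le farey_uniq sort_le_sorted. Qed.

Definition fden Q i : nat := nth 0%N (farey_den Q) i.
Definition fnum Q i : nat := `|numq (nth 0%R (farey Q) i)|%N.

Lemma farey_nthP Q i : (i < size (farey Q))%N ->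
  [/\ (0 < fden Q i <= Q)%N, (fnum Q i <= fden Q i)%N, coprime (fnum Q i) (fden Q i)
    & nth 0 (farey Q) i = qfrac (fnum Q i) (fden Q i)].
Proof.
move=> iF; have /mem_farey[a [q [hq aq c e]]] := mem_nth 0 iF.
have q0 : (0 < q)%N by case/andP: hq.
have -> : fden Q i = q by rewrite /fden (nth_map 0) // e denq_qfrac.
by have -> : fnum Q i = a by rewrite /fnum e numq_qfrac.
Qed.

Lemma coprime_det (a q a' q' : nat) : (a' * q = a * q' + 1)%N -> coprime q q'.
Proof.
move=> e; rewrite /coprime -dvdn1 -(dvdn_addr (m := a * q')).
  by rewrite -e dvdn_mull // dvdn_gcdl.
by rewrite dvdn_mull // dvdn_gcdr.
Qed.

(** One has [d = q * (a' * d - b * q') + q' * (b * q - a * d)], and both parentheses are positive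
    integers; [e] is this identity without subtraction. *)
Lemma mediant_gap (a q a' q' b d : nat) : (a' * q = a * q' + 1)%N ->
  (a * d < b * q)%N -> (b * q' < a' * d)%N -> (q + q' <= d)%N.
Proof.
move=> h h1 h2.
have e : (d + (q * (b * q') + q' * (a * d)) = q * (a' * d) + q' * (b * q))%N.
  have : (d * (a' * q) = d * (a * q' + 1))%N by rewrite h.
  by lia.
have h3 : (q * (b * q').+1 <= q * (a' * d))%N by rewrite leq_mul2l h2 orbT.
have h4 : (q' * (a * d).+1 <= q' * (b * q))%N by rewrite leq_mul2l h1 orbT.
by move: e h3 h4; rewrite !mulnS; lia.
Qed.

Lemma sorted_lt_nth_next (s : seq rat) i y : sorted <%R s -> (i < size s)%N -> y \in s ->
  nth 0 s i < y -> (forall z, z \in s -> nth 0 s i < z -> ~~ (z < y)) ->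
  (i.+1 < size s)%N /\ nth 0 s i.+1 = y.
Proof.
move=> ss si ys iy h.
have jy : (index y s < size s)%N by rewrite index_mem.
have ltn u v : (u < size s)%N -> (v < size s)%N -> (nth 0 s u < nth 0 s v) = (u < v)%N.
  by move=> us vs; rewrite lt_sorted_ltn_nth.
move: iy; rewrite -{1}(nth_index 0 ys) ltn // => ij.
have si1 : (i.+1 < size s)%N by exact: leq_ltn_trans jy.
split=> //; move: ij; rewrite leq_eqVlt => /orP[/eqP ->|ij]; first exact: nth_index.
have := h _ (mem_nth 0 si1); rewrite ltn // ltnSn => /(_ isT).
by rewrite -{1}(nth_index 0 ys) ltn // ij.
Qed.

(** A fraction strictly in between would have denominator at least [fden Q i + q'] by [mediant_gap],
    hence greater than [Q]. *)
Lemma farey_succ Q i a' q' : (i < size (farey Q))%N ->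
  (a' * fden Q i = fnum Q i * q' + 1)%N -> (a' <= q')%N -> (q' <= Q)%N ->
  (Q < fden Q i + q')%N ->
  [/\ (i.+1 < size (farey Q))%N, fden Q i.+1 = q' & fnum Q i.+1 = a'].
Proof.
move=> iF e aq q'Q Qq; have [/andP[q0 qQ] aq0 c ei] := farey_nthP iF.
have q'0 : (0 < q')%N by lia.
have c' : coprime a' q'.
  by apply: (@coprime_det (fnum Q i) a' (fden Q i) q'); rewrite mulnC.
have [|||i1 e1] := @sorted_lt_nth_next (farey Q) i (qfrac a' q') (farey_sorted Q) iF.
- by apply/mem_farey; exists a', q'; split => //; rewrite q'0.
- by rewrite ei qfrac_lt // e addn1.
- move=> z /mem_farey[b [d [/andP[d0 dQ] bd cbd ->]]].
  rewrite ei !qfrac_lt // => h1; apply/negP => h2.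
  by have := mediant_gap e h1 h2; lia.
split=> //; first by rewrite /fden (nth_map 0) // e1 denq_qfrac.
by rewrite /fnum e1 numq_qfrac.
Qed.

(** A neighbour with determinant 1 is constructed by Bezout, and [farey_succ] identifies it with the
    next element. *)
Lemma farey_next Q i : (i.+1 < size (farey Q))%N ->
  latT Q (fden Q i) (fden Q i.+1) /\
  (fnum Q i.+1 * fden Q i = fnum Q i * fden Q i.+1 + 1)%N.
Proof.
move=> i1; have iF := ltnW i1.
have [/andP[q0 qQ] aq c ei] := farey_nthP iF.
have [/andP[q0' qQ'] aq' c' ei'] := farey_nthP i1.
have alt : (fnum Q i < fden Q i)%N.
  have : nth 0 (farey Q) i < nth 0 (farey Q) i.+1.
    by rewrite lt_sorted_ltn_nth // farey_sorted.
  rewrite ei ei' qfrac_lt // => h.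
  have : (fnum Q i * fden Q i.+1 < fden Q i * fden Q i.+1)%N.
    by apply: leq_trans h _; rewrite mulnC leq_mul2l aq' orbT.
  by rewrite ltn_mul2r q0'.
have [u uq] := Bezoutl (fnum Q i) q0.
rewrite gcdnC (eqP c) => du.
set q := fden Q i in q0 qQ aq c ei alt u uq du *; set a := fnum Q i in aq c ei alt du *.
(* The representative of [u] modulo [q] in the window [Q - q < q' <= Q]. *)
pose q' := (u + q * ((Q - u) %/ q))%N.
have hq' : (q' <= Q)%N /\ (Q < q + q')%N.
  have h1 := leq_trunc_div (Q - u) q; have h2 := ltn_ceil (Q - u) q0.
  by rewrite /q'; move: h1 h2; rewrite mulSn mulnC; move: (q * _)%N => t; lia.
have dq' : (q %| a * q' + 1)%N.
  have -> : (a * q' + 1 = (1 + u * a) + q * (a * ((Q - u) %/ q)))%N.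
    by rewrite /q'; lia.
  by rewrite dvdn_addl // dvdn_mulr.
have e : ((a * q' + 1) %/ q * q = a * q' + 1)%N by rewrite divnK.
have [|||_ -> ->] := @farey_succ Q i ((a * q' + 1) %/ q) q' iF e.
- have : ((a * q' + 1) %/ q * q <= q' * q)%N.
    rewrite e; apply: (@leq_trans ((a.+1) * q')).
      by rewrite mulSn; case: hq'; lia.
    by rewrite mulnC leq_mul2l alt orbT.
  by rewrite leq_mul2r; lia.
- by case: hq'.
- by case: hq'.
by split=> //; rewrite /latT; case: hq'; lia.
Qed.

(** Comparing the two determinant relations shows that the middle denominator divides the sum of its
    neighbours. The quotient is the stated floor because the third denominator is at most [Q] and
    the last two sum to more than [Q]. *)
Lemma farey_next2 Q i : (i.+2 < size (farey Q))%N ->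
  fden Q i.+2 = ((Q + fden Q i) %/ fden Q i.+1 * fden Q i.+1 - fden Q i)%N.
Proof.
move=> i2; have [h e] := farey_next (ltnW i2); have [h' e'] := farey_next i2.
have [_ _ c _] := farey_nthP (ltnW i2).
have d : (fden Q i.+1 %| fden Q i + fden Q i.+2)%N.
  rewrite -(Gauss_dvdr (m := fden Q i.+1) (n := fnum Q i.+1)); last by rewrite coprime_sym.
  have -> : (fnum Q i.+1 * (fden Q i + fden Q i.+2) =
    fden Q i.+1 * (fnum Q i + fnum Q i.+2))%N by lia.
  by rewrite dvdn_mulr.
case/dvdnP: d => k hk; suff -> : ((Q + fden Q i) %/ fden Q i.+1)%N = k by lia.
move: h h' => /and5P[_ _ v0 _ _] /and5P[_ _ w0 wQ vw].
apply/eqP; rewrite eqn_leq -ltnS ltn_divLR // leq_divRL //.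
by rewrite mulSn -hk; lia.
Qed.

Lemma fden_qseq Q i j : (i.+1 < size (farey Q))%N -> (i + j < size (farey Q))%N ->
  fden Q (i + j) = qseq Q (fden Q i) (fden Q i.+1) j.
Proof.
move=> i1.
suff H : forall m, (i + m.+1 < size (farey Q))%N ->
    fden Q (i + m) = qseq Q (fden Q i) (fden Q i.+1) m /\
    fden Q (i + m.+1) = qseq Q (fden Q i) (fden Q i.+1) m.+1.
  by case: j => [|m] hm; [rewrite addn0|exact: (H m hm).2].
elim=> [|m IH] hm; first by rewrite addn0 addn1.
have hm' : (i + m.+1 < size (farey Q))%N by rewrite (leq_ltn_trans _ hm) // leq_add2l.
have [e1 e2] := IH hm'; split=> //.
rewrite !addnS in hm; by rewrite qseqSS /kseq -e1 -e2 !addnS farey_next2.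
Qed.

(** The denominators fix the numerator modulo [fden Q j], and a fraction with a successor has
    numerator below its denominator. The reduction to ordered numerators keeps natural subtraction
    exact. *)
Lemma farey_pair_inj Q i j : (i.+1 < size (farey Q))%N -> (j.+1 < size (farey Q))%N ->
  fden Q i = fden Q j -> fden Q i.+1 = fden Q j.+1 -> i = j.
Proof.
wlog le : i j / (fnum Q i <= fnum Q j)%N.
  move=> H i1 j1 e1 e2; case/orP: (leq_total (fnum Q i) (fnum Q j)) => le.
    exact: H.
  by symmetry; apply: H.
move=> i1 j1 e1 e2.
have [h e] := farey_next i1; have [h' e'] := farey_next j1.
have [/andP[q0 _] aq c ei] := farey_nthP (ltnW i1).
have [/andP[q0' _] aq' c' ej] := farey_nthP (ltnW j1).
have [/andP[q1 _] aq1 _ _] := farey_nthP j1.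
have cop := coprime_det e'.
have d : (fden Q j %| fnum Q j - fnum Q i)%N.
  rewrite -(Gauss_dvdr (m := fden Q j) (n := fden Q j.+1)) //.
  have -> : (fden Q j.+1 * (fnum Q j - fnum Q i) =
     fden Q j * (fnum Q j.+1 - fnum Q i.+1))%N.
    by rewrite !mulnBr -e1 -e2; move: e e'; rewrite -e1 -e2; lia.
  by rewrite dvdn_mulr.
have lt : (fnum Q j < fden Q j)%N.
  rewrite ltn_neqAle aq' andbT; apply/eqP => E.
  by move: e'; rewrite E => e'; nia.
have E : fnum Q i = fnum Q j.
  case: (posnP (fnum Q j - fnum Q i)) => [|p]; first by lia.
  by have := dvdn_leq p d; lia.
have : nth 0 (farey Q) i = nth 0 (farey Q) j by rewrite ei ej E e1.
by move/eqP; rewrite nth_uniq ?farey_uniq ?(ltnW i1) ?(ltnW j1) // => /eqP.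
Qed.

(** Bezout gives [a < q] with [q] dividing [a * q' + 1]; the fraction [a / q] then has a successor
    of denominator [q'] by [farey_succ]. *)
Lemma farey_pair_surj Q q q' : latT Q q q' -> coprime q q' ->
  exists i, [/\ (i.+1 < size (farey Q))%N, fden Q i = q & fden Q i.+1 = q'].
Proof.
move=> /and5P[q0 qQ q'0 q'Q Qq] cop.
have [a aq] := Bezoutl q' q0; rewrite (eqP cop) => da.
have e : ((1 + a * q') %/ q * q = a * q' + 1)%N by rewrite divnK // addnC.
have c : coprime a q.
  rewrite coprime_sym; apply: (@coprime_det q' q ((1 + a * q') %/ q) a).
  by rewrite e mulnC.
have xF : qfrac a q \in farey Q.
  by apply/mem_farey; exists a, q; split=> //; [rewrite q0|exact: ltnW].
have iF : (index (qfrac a q) (farey Q) < size (farey Q))%N by rewrite index_mem.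
set i := index _ _ in iF.
have en : nth 0 (farey Q) i = qfrac a q by exact: nth_index.
have ed : fden Q i = q by rewrite /fden (nth_map 0) // en denq_qfrac.
have ea : fnum Q i = a by rewrite /fnum en numq_qfrac.
have [||//||i1 e1 _] := @farey_succ Q i ((1 + a * q') %/ q) q' iF.
- by rewrite ed ea.
- have : ((1 + a * q') %/ q * q <= q' * q)%N.
    rewrite e; apply: (@leq_trans (a.+1 * q')); first by rewrite mulSn; lia.
    by rewrite mulnC leq_mul2l aq orbT.
  by rewrite leq_mul2r; lia.
- by rewrite ed.
by exists i.
Qed.

Lemma farey_size_gt0 Q : (0 < Q)%N -> (1 < size (farey Q))%N.
Proof.
move=> Q0; have lat : latT Q 1 Q by rewrite /latT; lia.
by have [i [i1 _ _]] := farey_pair_surj lat (coprime1n Q); lia.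
Qed.

Lemma count_farey_pairs Q (S : nat -> nat -> bool) :
  count (fun i => S (fden Q i) (fden Q i.+1)) (iota 0 (size (farey Q)).-1) =
  cnt Q (fun a b => [&& latT Q a b, coprime a b & S a b]).
Proof.
have lti i : i \in iota 0 (size (farey Q)).-1 -> (i.+1 < size (farey Q))%N.
  by rewrite mem_iota; lia.
(* The indicator of a coprime lattice point is the number of positions with that pair of
   denominators: exactly one by surjectivity and injectivity, none for other pairs. *)
have H a b : ([&& latT Q a b, coprime a b & S a b] : nat) =
  (\sum_(i <- iota 0 (size (farey Q)).-1)
     [&& fden Q i == a, fden Q i.+1 == b & S a b])%N.
  have [/andP[lat cop]|nlc] := boolP (latT Q a b && coprime a b).
    have [i [i1 ea eb]] := farey_pair_surj lat cop.
    rewrite lat cop (bigD1_seq i) ?iota_uniq //=; last by rewrite mem_iota; lia.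
    rewrite ea eb !eqxx big_seq_cond big1 ?addn0 // => j /andP[/lti j1 ji].
    case: eqP => //= ja; case: eqP => //= jb.
    by case/eqP: ji; apply: (@farey_pair_inj Q) => //; rewrite ?ja ?jb.
  rewrite andbA (negbTE nlc) big_seq big1 // => i /lti i1.
  case: eqP => //= ia; case: eqP => //= ib; case/negP: nlc.
  by have [lat e] := farey_next i1; rewrite -ia -ib lat (coprime_det e).
rewrite /cnt; under [RHS]eq_bigr => p _ do rewrite H.
rewrite exchange_big /= -sum1_count big_mkcond /= big_seq [RHS]big_seq.
apply: eq_bigr => i /lti i1.
have [/and5P[_ aQ _ bQ _] _] := farey_next i1.
rewrite -ltnS in aQ; rewrite -ltnS in bQ.
rewrite (bigD1 (Ordinal aQ, Ordinal bQ)) //= !eqxx big1 ?addn0.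
  by case: (S _ _).
move=> [u v] /= uv; case: eqP => //= ua; case: eqP => //= vb.
by case/eqP: uv; congr (_, _); exact/val_inj.
Qed.

(** * Limits of the densities *)

Lemma cnt_parity Q (S : nat -> nat -> bool) :
  cnt Q (fun a b => [&& latT Q a b, coprime a b & S a b]) =
  (cnt Q (fun a b => [&& prim true false a b, latT Q a b & S a b]) +
   cnt Q (fun a b => [&& prim false true a b, latT Q a b & S a b]) +
   cnt Q (fun a b => [&& prim true true a b, latT Q a b & S a b]))%N.
Proof.
rewrite /cnt -!big_split /=; apply: eq_bigr => -[a b] _ /=.
have [lat|] := boolP (latT Q a b); last by rewrite !andbF.
have [cab|] := boolP (coprime a b); last by rewrite /prim => /negbTE ->; rewrite !andbF.
move: lat (coprime_odd cab) => /and5P[a0 _ b0 _ _]; rewrite /prim a0 b0 cab /=.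
by case: (odd a); case: (odd b); case: (S a b).
Qed.

Lemma modn2P m n : (m = n %[mod 2]) <-> odd m = odd n.
Proof. by rewrite !modn2; split=> [|->//]; case: (odd m); case: (odd n). Qed.

Lemma lattice_ptP Q a b : lattice_pt Q a b <-> latT Q a b /\ coprime a b.
Proof.
rewrite /latT; split=> [[/andP[-> ->] /andP[-> ->] -> ->]//|[/and5P[a0 aQ b0 bQ h] c]].
by split=> //; apply/andP.
Qed.

Lemma odd_qseq Q a b n : latT Q a b ->
  odd (qseq Q a b n.+2) =
  (odd (kseq Q a b n) && odd (qseq Q a b n.+1)) (+) odd (qseq Q a b n).
Proof.
move=> h; have := congr1 odd (qseq_rec n h).
by rewrite oddD oddM => <-; rewrite -addbA addbb addbF.
Qed.

(* Modulo 2 the denominators depend only on the vector k and on the parities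
   of the first two of them. *)
Lemma odd_qseq_eq s Q a b Q' a' b' : latT Q a b -> latT Q' a' b' ->
  odd a = odd a' -> odd b = odd b' ->
  (forall j, (j < s)%N -> kseq Q a b j = kseq Q' a' b' j) ->
  forall j, (j <= s)%N -> odd (qseq Q a b j) = odd (qseq Q' a' b' j) /\
    odd (qseq Q a b j.+1) = odd (qseq Q' a' b' j.+1).
Proof.
move=> lat lat' ea eb ek; elim=> [|j IH] js; first by [].
have [e1 e2] := IH (ltnW js); split=> //.
by rewrite (odd_qseq j lat) (odd_qseq j lat') ek // e1 e2.
Qed.

Lemma congr_mod2P r (c : r.-tuple nat) (q : nat -> nat) :
  congr_mod 2 q c <-> forall j, (j < r)%N -> odd (q j) = odd (nth 0%N c j).
Proof.
split=> [h j jr|h j]; last by apply/modn2P; rewrite (tnth_nth 0%N) h.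
by have /modn2P := h (Ordinal jr); rewrite (tnth_nth 0%N).
Qed.

Lemma Kset_kvec r (c : r.-tuple nat) Q a b : latT Q a b -> coprime a b ->
  congr_mod 2 (qseq Q a b) c -> Kset c 2 (kvec (r - 2) Q a b).
Proof.
move=> lat cab h.
have Q1 : (1 <= Q)%N by case/and5P: lat => a0 aQ _ _ _; exact: leq_trans aQ.
have lp : lattice_pt Q a b by exact/lattice_ptP.
have hk : has_kvec Q a b (kvec (r - 2) Q a b) by move=> j; rewrite tnth_mktuple.
split; last by exists Q, a, b.
by split=> [j|]; [rewrite tnth_mktuple kseq_gt0|exists Q, a, b].
Qed.

(** Conversely, [Kset] supplies some lattice point with the same [k] and with denominators congruent
    to [c]; its first two parities are those of [a] and [b], so [odd_qseq_eq] transfers the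
    congruence. *)
Lemma congr_qseq_Kset r (c : r.-tuple nat) (r2 : (2 <= r)%N) Q a b :
  latT Q a b -> coprime a b ->
  congr_mod 2 (qseq Q a b) c <->
  [/\ odd a = odd (nth 0%N c 0), odd b = odd (nth 0%N c 1) & Kset c 2 (kvec (r - 2) Q a b)].
Proof.
move=> lat cab; split=> [h|[ea eb [_ [Q' [a' [b' [_ lp hk h]]]]]]].
  have /congr_mod2P h' := h.
  by split; [exact: (h' 0%N (ltnW r2))|exact: (h' 1%N r2)|exact: Kset_kvec].
have /lattice_ptP[lat' _] := lp; move/congr_mod2P in h; apply/congr_mod2P.
have ek j : (j < r - 2)%N -> kseq Q a b j = kseq Q' a' b' j.
  by move=> jr; have := hk (Ordinal jr); rewrite tnth_mktuple.
have ea' : odd a = odd a' by rewrite ea -(h 0%N (ltnW r2)).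
have eb' : odd b = odd b' by rewrite eb -(h 1%N r2).
have H := odd_qseq_eq lat lat' ea' eb' ek.
case=> [|j] jr; first by rewrite -(h 0%N (ltnW r2)).
rewrite -(h j.+1 jr); apply: (H j _).2.
by rewrite leq_subRL // add2n.
Qed.

(** Every starting position of an [r]-tuple starts a pair, and at most [r - 2] positions start a
    pair but no [r]-tuple. *)
Lemma farey_count_pairs Q r (c : r.-tuple nat) : (2 <= r)%N ->
  (farey_count Q c 2
   <= cnt Q (fun a b => [&& latT Q a b, coprime a b & `[< congr_mod 2 (qseq Q a b) c >]])
   <= farey_count Q c 2 + r)%N.
Proof.
move=> r2; rewrite -(count_farey_pairs Q (fun a b => `[< congr_mod 2 (qseq Q a b) c >])).
set n := size (farey Q).
have -> : farey_count Q c 2 =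
    count (fun i => `[< congr_mod 2 (qseq Q (fden Q i) (fden Q i.+1)) c >])
      (iota 0 (n - (r - 1))).
  apply: eq_in_count => i; rewrite mem_iota add0n => /andP[_ hi].
  apply: asbool_equiv_eq; split=> h j; have := h j; have jr := ltn_ord j.
    by rewrite -/(fden Q (i + j)) fden_qseq //; rewrite -/n; lia.
  by rewrite -/(fden Q (i + j)) fden_qseq //; rewrite -/n; lia.
have -> : n.-1 = ((n - (r - 1)) + (n.-1 - (n - (r - 1))))%N by lia.
rewrite iotaD count_cat leq_addr leq_add2l /=.
by apply: leq_trans (count_size _ _) _; rewrite size_iota; lia.
Qed.

Section Limits.
Variable R : realType.
Local Notation mu := (@lebesgue_measure R \x @lebesgue_measure R)%E.
Local Notation kappa := (kappa R).

Lemma cvg_bounded (x : nat -> R) (C : R) : (forall Q, `|x Q| <= C) ->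
  (x Q / Q%:R ^+ 2) @[Q --> \oo] --> (0 : R).
Proof.
move=> hx.
have h1 : (x Q / Q%:R) @[Q --> \oo] --> (0 : R).
  by apply: (@cvg_ratio _ _ _ C) => Q; rewrite mul0r subr0.
have h2 : (1 / Q%:R) @[Q --> \oo] --> (0 : R).
  by apply: (@cvg_ratio _ (fun=> 1) _ 1) => Q; rewrite mul0r subr0 normr1.
have := cvgnM h1 h2; rewrite mulr0; apply: cvgn_near_eq; apply: nearW => Q.
by rewrite expr2 invfM mul1r mulrA.
Qed.

Lemma region_setT : region R [set: 0.-tuple nat] = @fareyT R.
Proof.
apply/seteqP; split=> [p [k _ []]//|p Tp].
by exists [tuple] => //; split=> // -[].
Qed.

Lemma cvg_class (e1 e2 : bool) : e1 || e2 ->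
  ((cnt Q (fun a b => [&& prim e1 e2 a b, latT Q a b & true]))%:R / Q%:R ^+ 2 : R)
    @[Q --> \oo] --> kappa / 2.
Proof.
move=> e; have := @cvg_cnt_lattice R 0 setT e1 e2 e.
rewrite region_setT area_fareyT /=; apply: cvgn_near_eq; apply: nearW => Q.
by congr (_%:R / _); apply: eq_cnt => a b _ _; rewrite asboolT.
Qed.

(** There is one fraction more than there are pairs, and each of the three parity classes of pairs
    contributes [kappa / 2]. The shift [x] will be [r - 1]. *)
Lemma cvg_size_farey (x : R) :
  (((size (farey Q))%:R - x) / Q%:R ^+ 2) @[Q --> \oo] --> 3 / 2 * kappa.
Proof.
have h := cvgnD (cvgnD (@cvg_class true false isT) (@cvg_class false true isT))
  (@cvg_class true true isT).
have h' := @cvg_bounded (fun=> 1 - x) `|1 - x| (fun=> lexx _).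
have := cvgnD h h'.
have -> : kappa / 2 + kappa / 2 + kappa / 2 + 0 = 3 / 2 * kappa by field.
apply: cvgn_near_eq; near=> Q.
have Q0 : (0 < Q)%N by near: Q; exact: nbhs_infty_gt.
rewrite -!mulrDl -!natrD -cnt_parity -count_farey_pairs count_predT size_iota.
congr (_ / _); rewrite addrA natr1 prednK //.
exact: ltnW (farey_size_gt0 Q0).
Unshelve. all: by end_near. Qed.

Lemma cvg_rho (r : nat) (c : r.-tuple nat) (N : nat -> nat) (l C : R) :
  (forall Q, `|(farey_count Q c 2)%:R - (N Q)%:R| <= C) ->
  ((N Q)%:R / Q%:R ^+ 2 : R) @[Q --> \oo] --> l ->
  rhoQ R c 2 Q @[Q --> \oo] --> l / (3 / 2 * kappa).
Proof.
move=> hC hN.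
have k0 := kappa_gt0 R.
have t0 : 3 / 2 * kappa != 0 by rewrite gt_eqF // mulr_gt0 // divr_gt0.
have h1 := cvgnD hN (cvg_bounded hC); rewrite addr0 in h1.
have h2 := cvg_size_farey (r%:R - 1).
have h3 : (((size (farey Q))%:R - (r%:R - 1)) / Q%:R ^+ 2)^-1 @[Q --> \oo] --> (3 / 2 * kappa)^-1.
  by apply: cvgV.
have := cvgnM h1 h3; apply: cvgn_near_eq; near=> Q.
have Q0 : Q%:R ^+ 2 != 0 :> R.
  by rewrite expf_neq0 // pnatr_eq0 -lt0n; near: Q; exact: nbhs_infty_gt.
by rewrite -mulrDl (addrC (N Q)%:R) subrK /rhoQ invf_div mulrA divfK.
Unshelve. all: by end_near. Qed.

Lemma region_Kset_empty r (c : r.-tuple nat) : (2 <= r)%N ->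
  ~~ (odd (nth 0%N c 0) || odd (nth 0%N c 1)) -> Kset c 2 = set0.
Proof.
move=> r2 ne; rewrite -subset0 => k [_ [Q [a [b [_ /lattice_ptP[lat cab] _ h]]]]].
have [ea eb _] := (congr_qseq_Kset c r2 lat cab).1 h.
by case/negP: ne; rewrite -ea -eb coprime_odd.
Qed.

Lemma cvg_rho_ge2 (r : nat) (c : r.-tuple nat) : (2 <= r)%N ->
  rhoQ R c 2 Q @[Q --> \oo] --> 2 / 3 * fine (mu (region R (Kset c 2))).
Proof.
move=> r2; have k0 := kappa_gt0 R.
have -> : 2 / 3 * fine (mu (region R (Kset c 2))) =
    (kappa * fine (mu (region R (Kset c 2)))) / (3 / 2 * kappa).
  by field; rewrite gt_eqF.
apply: (@cvg_rho r c (fun Q => cnt Q (fun a b => [&& latT Q a b, coprime a b &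
    `[< congr_mod 2 (qseq Q a b) c >]])) _ r%:R).
  move=> Q; have /andP[h1 h2] := farey_count_pairs Q c r2.
  rewrite distrC ger0_norm ?subr_ge0 ?ler_nat // lerBlDr -natrD ler_nat.
  by rewrite addnC.
set e1 := odd (nth 0%N c 0); set e2 := odd (nth 0%N c 1).
(* Two even leading entries contradict coprimality: the count and the region are then both empty. *)
have [e|ne] := boolP (e1 || e2); last first.
  rewrite (region_Kset_empty r2 ne) /region bigcup_set0 measure0 /= mulr0.
  apply: cvgn_near_eq (cvg_cst (0 : R)); apply: nearW => Q; apply/esym/eqP.
  rewrite mulf_eq0 pnatr_eq0 /cnt big1 // => -[a b] _ /=.
  apply/eqP; rewrite eqb0; apply/negP => /and3P[lat cab /asboolP h].
  have [ea eb _] := (congr_qseq_Kset c r2 lat cab).1 h.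
  by case/negP: ne; rewrite /e1 /e2 -ea -eb coprime_odd.
have := @cvg_cnt_lattice R (r - 2) (Kset c 2) e1 e2 e.
apply: cvgn_near_eq; apply: nearW => Q; congr (_%:R / _); apply: eq_cnt => a b _ _.
apply/idP/idP.
  move=> /and3P[/and5P[a0 b0 cab /eqP ea /eqP eb] lat /asboolP hK].
  by rewrite lat cab /=; apply/asboolP/congr_qseq_Kset.
move=> /and3P[lat cab /asboolP h]; have [ea eb hK] := (congr_qseq_Kset c r2 lat cab).1 h.
rewrite lat /prim cab ea eb !eqxx /=; case/and5P: (lat) => -> _ -> _ _ /=.
exact/asboolP.
Qed.

(** The last fraction has a denominator but starts no pair, hence the discrepancy of at most 1. *)
Lemma farey_count1 Q (c : 1.-tuple nat) :
  (farey_count Q c 2 - 1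
   <= cnt Q (fun a b => [&& latT Q a b, coprime a b & odd a == odd (tnth c ord0)])
   <= farey_count Q c 2)%N.
Proof.
rewrite -(count_farey_pairs Q (fun a _ => odd a == odd (tnth c ord0))).
have -> : farey_count Q c 2 =
    count (fun i => odd (fden Q i) == odd (tnth c ord0)) (iota 0 (size (farey Q))).
  rewrite /farey_count subn0; apply: eq_count => i; apply/asboolP/eqP => [h|h j].
    by have /modn2P := h ord0; rewrite addn0.
  by apply/modn2P; rewrite ord1 addn0.
have [n0|n0] := posnP (size (farey Q)); first by rewrite n0.
rewrite -[in iota 0 (size _)](prednK n0) -(addn1 (size (farey Q)).-1) iotaD count_cat leq_addr andbT.
by rewrite leq_subLR addnC leq_add2r /=; case: (odd _ == _).
Qed.

(** An odd first denominator occurs in two of the three parity classes, an even one in a single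
    class. *)
Lemma cvg_rho1 (c : 1.-tuple nat) :
  rhoQ R c 2 Q @[Q --> \oo] --> (if odd (tnth c ord0) then 2 / 3 else 1 / 3 : R).
Proof.
have k0 := kappa_gt0 R.
have -> : (if odd (tnth c ord0) then 2 / 3 else 1 / 3 : R) =
    (if odd (tnth c ord0) then kappa else kappa / 2) / (3 / 2 * kappa).
  by case: odd; field; rewrite gt_eqF.
apply: (@cvg_rho 1 c (fun Q => cnt Q (fun a b => [&& latT Q a b, coprime a b &
    odd a == odd (tnth c ord0)])) _ 1).
  move=> Q; have /andP[h1 h2] := farey_count1 Q c.
  rewrite ger0_norm ?subr_ge0 ?ler_nat // lerBlDr nat1r ler_nat.
  by move: h1; rewrite leq_subLR add1n.
have zero e e' : e' != e -> forall e2 Q,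
    cnt Q (fun a b => [&& prim e' e2 a b, latT Q a b & odd a == e]) = 0%N.
  move=> ne e2 Q; rewrite /cnt big1 // => -[a b] _ /=; apply/eqP; rewrite eqb0.
  apply/negP => /and3P[/and5P[_ _ _ /eqP ea _] _ /eqP ea'].
  by case/eqP: ne; rewrite -ea -ea'.
have one e e2 Q : cnt Q (fun a b => [&& prim e e2 a b, latT Q a b & odd a == e]) =
    cnt Q (fun a b => [&& prim e e2 a b, latT Q a b & true]).
  apply: eq_cnt => a b _ _; case: (boolP (prim e e2 a b)) => //= /and5P[_ _ _ ea _].
  by rewrite ea.
case: odd.
  have := cvgnD (@cvg_class true false isT) (@cvg_class true true isT).
  have -> : kappa / 2 + kappa / 2 = kappa by field.
  apply: cvgn_near_eq; apply: nearW => Q.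
  by rewrite cnt_parity (zero true false) // !one addn0 natrD mulrDl.
have := @cvg_class false true isT.
apply: cvgn_near_eq; apply: nearW => Q.
by rewrite cnt_parity !(zero false true) // !one addn0.
Qed.

(** For [r = 2] the only candidate [k] is the empty tuple, whose cell is the whole triangle; a
    single lattice point with the right parities places it in [Kset]. *)
Lemma region_Kset2 (c : 2.-tuple nat) Q a b : lattice_pt Q a b ->
  congr_mod 2 (qseq Q a b) c -> region R (Kset c 2) = @fareyT R.
Proof.
move=> lp h; have Q1 : (1 <= Q)%N by case: lp => /andP[a0 aQ] _ _ _; exact: leq_trans aQ.
apply/seteqP; split=> [p [k _ []]//|p Tp].
exists [tuple]; last by split=> // -[].
by split; [split=> [[]//|]|]; exists Q, a, b; split=> // -[].
Qed.

Lemma fin_region s (P : set (s.-tuple nat)) : mu (region R P) \is a fin_num.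
Proof.
rewrite ge0_fin_numE ?measure_ge0 //.
apply: (@le_lt_trans _ _ (mu (ubox R))); last by rewrite area_ubox ltry.
apply: le_measure; rewrite ?inE; [exact: measurable_region|exact: measurable_ubox|].
exact: region_sub.
Qed.

Lemma rho2 (c : 2.-tuple nat) Q a b : lattice_pt Q a b ->
  congr_mod 2 (qseq Q a b) c -> rho R c 2 = 1 / 3.
Proof.
move=> lp h; rewrite /rho (cvg_lim _ (@cvg_rho_ge2 2 c isT)) //.
by rewrite (region_Kset2 lp h) area_fareyT /=; field.
Qed.
End Limits.

Theorem theorem4 (R : realType) :
  (forall (r : nat) (c : r.-tuple nat), (1 <= r)%N ->
     (forall j : 'I_r, (tnth c j < 2)%N) -> cvgn (rhoQ R c 2)) /\
  (rho R [tuple 0%N] 2 = 1 / 3 /\ rho R [tuple 1%N] 2 = 2 / 3) /\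
  (rho R [tuple 0%N; 1%N] 2 = 1 / 3 /\ rho R [tuple 1%N; 0%N] 2 = 1 / 3 /\
   rho R [tuple 1%N; 1%N] 2 = 1 / 3) /\
  (forall (r : nat) (c : r.-tuple nat), (3 <= r)%N ->
     (forall j : 'I_r, (tnth c j < 2)%N) ->
     ((rho R c 2)%:E = (2 / 3)%:E * \esum_(k in Kset c 2) area (fareyTk R k))%E).
Proof.
split; [|split; [|split]].
- move=> r c r1 _; case: r r1 c => [//|[|r]] _ c.
    by apply/cvg_ex; eexists; exact: cvg_rho1.
  by apply/cvg_ex; eexists; exact: cvg_rho_ge2.
- by split; rewrite /rho (cvg_lim _ (@cvg_rho1 R _)).
- split; [|split].
  (* The witnesses are neighbours in small Farey sequences: denominators 1, 2, 1 at order 2, and 1,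
     1 at order 1. *)
  + by apply: (@rho2 R _ 2 2 1) => // -[[|[|]]].
  + by apply: (@rho2 R _ 2 1 2) => // -[[|[|]]].
  + by apply: (@rho2 R _ 1 1 1) => // -[[|[|]]].
- move=> r c r3 _; rewrite /rho (cvg_lim _ (@cvg_rho_ge2 R r c (ltnW r3))) //.
  by rewrite EFinM fineK ?fin_region // area_region.
Qed.
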